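(* Let $(R,\mathfrak m)$ be an excellent local ring and let $I$ be an ideal of $R$ such that $V(I)=\{\mathfrak p\in\operatorname{Spec}(R): R_{\mathfrak p}\text{ is not Cohen--Macaulay}\}$. Then $\operatorname{pd}_R(E_R(R/\mathfrak p))=\infty$ for all $\mathfrak p\in V(I)$.
   Context: Rings are commutative and noetherian. $V(I)$ is the set of prime ideals containing $I$. For an excellent ring the non-Cohen--Macaulay locus is a Zariski-closed subset of $\operatorname{Spec}(R)$, so an ideal $I$ as in the statement exists; it is called the defining ideal of the non-Cohen--Macaulay locus. $E_R(N)$ denotes the injective envelope of an $R$-module $N$, and $\operatorname{pd}_R$ denotes projective dimension. *)

(* Defs.v *)
From HB Require Import structures.
From mathcomp Require Import all_boot all_order all_algebra.
From mathcomp Require Import fieldext ring.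
From mathcomp Require Import boolp.

Set Implicit Arguments.
Unset Strict Implicit.
Unset Printing Implicit Defensive.

Import GRing.Theory.

Local Open Scope ring_scope.
Local Open Scope quotient_scope.

(* The library's [idealr R] contains only the proper ideals; [ideal] also
   allows the unit ideal. *)
Definition ideal (R : comNzRingType) (I : {pred R}) : Prop :=
  submod_closed (I : {pred R^o}).

Notation Spec R := (prime_idealr R).

Definition V (R : comNzRingType) (I : {pred R}) (p : Spec R) : Prop :=
  {subset I <= p}.

Definition generated_by (R : comNzRingType) (s : seq R) (x : R) : Prop :=
  exists c : 'I_(size s) -> R, x = \sum_i c i * s`_i.

Definition noetherian (R : comNzRingType) : Prop :=
  forall I : {pred R}, ideal I ->
  exists s : seq R, forall x, x \in I <-> generated_by s x.

Definition maximal_ideal (R : comNzRingType) (m : idealr R) : Prop :=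
  forall J : idealr R, {subset m <= J} -> J =i m.

Definition local_ring (R : comNzRingType) (m : idealr R) : Prop :=
  maximal_ideal m /\ forall J : idealr R, maximal_ideal J -> J =i m.

Module Localization.
Section Localization.
Variables (R : comNzRingType) (p : Spec R).

Record frac := Frac { num : R; den : R; denP : den \notin p }.

HB.instance Definition _ := gen_eqMixin frac.
HB.instance Definition _ := gen_choiceMixin frac.

Implicit Types x y z : frac.

Definition equivf x y : bool :=
  `[< exists2 u, u \notin p & u * (num x * den y) = u * (num y * den x) >].

Lemma one_notin : (1 : R) \notin p. Proof. by rewrite idealr1. Qed.

Lemma mul_notin u v : u \notin p -> v \notin p -> u * v \notin p.
Proof. by move=> pu pv; rewrite prime_idealrM negb_or pu. Qed.

Lemma equivf_refl : reflexive equivf.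
Proof. by move=> x; apply/asboolP; exists 1 => //; exact: one_notin. Qed.

Lemma equivf_sym : symmetric equivf.
Proof. by move=> x y; apply/asboolP/asboolP => -[u pu e]; exists u. Qed.

Lemma equivf_trans : transitive equivf.
Proof.
move=> y x z /asboolP[u pu e] /asboolP[v pv f]; apply/asboolP.
exists (u * v * den y); first by rewrite !mul_notin ?denP.
transitivity (v * den z * (u * (num x * den y))); first by ring.
rewrite e.
transitivity (u * den x * (v * (num y * den z))); first by ring.
by rewrite f; ring.
Qed.

Canonical equivf_equiv := EquivRel equivf equivf_refl equivf_sym equivf_trans.

Definition type := {eq_quot equivf}.
HB.instance Definition _ : EqQuotient _ equivf type := EqQuotient.on type.
HB.instance Definition _ := Choice.on type.

Lemma equivP x y :
  reflect (exists2 u, u \notin p & u * (num x * den y) = u * (num y * den x))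
          (x == y %[mod type]).
Proof. by rewrite eqmodE; exact: asboolP. Qed.

Lemma pi_eq x y : num x * den y = num y * den x -> \pi_type x = \pi_type y.
Proof. by move=> e; apply/eqP/equivP; exists 1; rewrite ?one_notin ?e. Qed.

Lemma reprP x : exists2 u, u \notin p &
  u * (num (repr (\pi_type x)) * den x) = u * (num x * den (repr (\pi_type x))).
Proof. by apply/equivP; rewrite reprK. Qed.

Definition fracC a : frac := Frac a one_notin.
Definition addf x y : frac :=
  Frac (num x * den y + num y * den x) (mul_notin (denP x) (denP y)).
Definition oppf x : frac := Frac (- num x) (denP x).
Definition mulf x y : frac :=
  Frac (num x * num y) (mul_notin (denP x) (denP y)).

Definition add (a b : type) : type := \pi_type (addf (repr a) (repr b)).
Definition opp (a : type) : type := \pi_type (oppf (repr a)).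
Definition mul (a b : type) : type := \pi_type (mulf (repr a) (repr b)).

Lemma pi_add x y : add (\pi_type x) (\pi_type y) = \pi_type (addf x y).
Proof.
have [u pu e] := reprP x; have [v pv f] := reprP y.
apply/eqP/equivP; exists (u * v); first exact: mul_notin.
move: e f; rewrite /=.
set x' := repr _; set y' := repr _ => e f.
transitivity (u * (num x' * den x) * (v * den y * den y')
  + v * (num y' * den y) * (u * den x * den x')); first by ring.
by rewrite e f; ring.
Qed.

Lemma pi_opp x : opp (\pi_type x) = \pi_type (oppf x).
Proof.
have [u pu e] := reprP x.
by apply/eqP/equivP; exists u => //=; rewrite !mulNr !mulrN e.
Qed.

Lemma pi_mul x y : mul (\pi_type x) (\pi_type y) = \pi_type (mulf x y).
Proof.
have [u pu e] := reprP x; have [v pv f] := reprP y.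
apply/eqP/equivP; exists (u * v); first exact: mul_notin.
move: e f; rewrite /=.
set x' := repr _; set y' := repr _ => e f.
transitivity (u * (num x' * den x) * (v * (num y' * den y))); first by ring.
by rewrite e f; ring.
Qed.

Lemma addA : associative add.
Proof.
elim/quotW=> x; elim/quotW=> y; elim/quotW=> z; rewrite (pi_add y z) (pi_add x y) !pi_add.
by apply: pi_eq => /=; ring.
Qed.

Lemma addC : commutative add.
Proof.
by elim/quotW=> x; elim/quotW=> y; rewrite !pi_add; apply: pi_eq => /=; ring.
Qed.

Lemma add0 : left_id (\pi_type (fracC 0)) add.
Proof. by elim/quotW=> x; rewrite pi_add; apply: pi_eq => /=; ring. Qed.

Lemma addN : left_inverse (\pi_type (fracC 0)) opp add.
Proof. by elim/quotW=> x; rewrite (pi_opp x) pi_add; apply: pi_eq => /=; ring. Qed.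

HB.instance Definition _ := GRing.isZmodule.Build type addA addC add0 addN.

Lemma mulA : associative mul.
Proof.
elim/quotW=> x; elim/quotW=> y; elim/quotW=> z; rewrite (pi_mul y z) (pi_mul x y) !pi_mul.
by apply: pi_eq => /=; ring.
Qed.

Lemma mulC : commutative mul.
Proof.
by elim/quotW=> x; elim/quotW=> y; rewrite !pi_mul; apply: pi_eq => /=; ring.
Qed.

Lemma mul1 : left_id (\pi_type (fracC 1)) mul.
Proof. by elim/quotW=> x; rewrite pi_mul; apply: pi_eq => /=; ring. Qed.

Lemma mul_addl : left_distributive mul add.
Proof.
elim/quotW=> x; elim/quotW=> y; elim/quotW=> z.
by rewrite (pi_add x y) (pi_mul x z) (pi_mul y z) pi_mul pi_add; apply: pi_eq => /=; ring.
Qed.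

Lemma one_neq0 : \pi_type (fracC 1) != \pi_type (fracC 0).
Proof.
apply/equivP => -[u pu]; rewrite /= mul0r !mulr1 mulr0 => u0.
by move: pu; rewrite u0 idealr0.
Qed.

HB.instance Definition _ :=
  GRing.Zmodule_isComNzRing.Build type mulA mulC mul1 mul_addl one_neq0.

End Localization.
End Localization.
HB.export Localization.

Definition localization (R : comNzRingType) (p : Spec R) : comNzRingType :=
  Localization.type p.

Module ResidueDomain.
Section ResidueDomain.
Variables (R : comNzRingType) (p : Spec R).

Definition type := {ideal_quot p}.
HB.instance Definition _ := GRing.ComNzRing.on type.

Definition unit : {pred type} := fun x => `[< exists y, y * x = 1 >].

Definition inv (x : type) : type :=
  if pselect (exists y, y * x = 1) is left h then projT1 (cid h) else x.

Lemma mulVx : {in unit, left_inverse 1 inv *%R}.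
Proof.
move=> x /asboolP ux; rewrite /inv; case: pselect => // h.
exact: projT2 (cid h).
Qed.

Lemma unitP (x y : type) : y * x = 1 -> unit x.
Proof. by move=> yx; apply/asboolP; exists y. Qed.

Lemma inv_out : {in [predC unit], inv =1 id}.
Proof.
move=> x /= ux; rewrite /inv; case: pselect => // h.
by case/negP: ux; apply/asboolP.
Qed.

HB.instance Definition _ :=
  GRing.ComNzRing_hasMulInverse.Build type mulVx unitP inv_out.

Lemma integral : GRing.integral_domain_axiom type.
Proof. exact: Quotient.rquot_IdomainAxiom. Qed.

HB.instance Definition _ := GRing.ComUnitRing_isIntegral.Build type integral.

End ResidueDomain.
End ResidueDomain.
HB.export ResidueDomain.

Definition residue_field (R : comNzRingType) (p : Spec R) : fieldType :=
  {fraction (ResidueDomain.type p)}.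

Definition to_residue_field (R : comNzRingType) (p : Spec R) :
    {rmorphism R -> residue_field p} :=
  (@tofrac (ResidueDomain.type p))
    \o (\pi_{ideal_quot p} : {rmorphism R -> ResidueDomain.type p}).

Definition prime_lt (R : comNzRingType) (p q : Spec R) : Prop :=
  {subset p <= q} /\ ~ {subset q <= p}.

Definition has_prime_chain (R : comNzRingType) (n : nat) : Prop :=
  exists c : nat -> Spec R, forall i, (i < n)%N -> prime_lt (c i) (c i.+1).

Definition krull_dim (R : comNzRingType) (n : nat) : Prop :=
  has_prime_chain R n /\ forall k, has_prime_chain R k -> (k <= n)%N.

Definition regular_sequence (R : comNzRingType) (s : seq R) : Prop :=
  ~ generated_by s 1 /\
  forall i, (i < size s)%N ->
  forall x, generated_by (take i s) (s`_i * x) -> generated_by (take i s) x.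

Definition depth (R : comNzRingType) (m : idealr R) (n : nat) : Prop :=
  (exists2 s : seq R, {subset s <= m} & regular_sequence s /\ size s = n) /\
  forall s : seq R, {subset s <= m} -> regular_sequence s -> (size s <= n)%N.

Definition cohen_macaulay_local (R : comNzRingType) : Prop :=
  noetherian R /\
  exists m : idealr R, local_ring m /\ exists n, krull_dim R n /\ depth m n.

Definition regular_local (R : comNzRingType) : Prop :=
  noetherian R /\
  exists m : idealr R, local_ring m /\
  exists s : seq R,
    (forall x, x \in m <-> generated_by s x) /\ krull_dim R (size s).

Definition regular_ring (R : comNzRingType) : Prop :=
  noetherian R /\ forall p : Spec R, regular_local (localization p).

Definition finite_type (R B : comNzRingType) (f : {rmorphism R -> B}) : Prop :=
  exists s : seq B, forall C : {pred B},
    subring_closed C -> (forall a, f a \in C) -> {subset s <= C} ->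
  forall b, b \in C.

Definition covers (R : comNzRingType) (p q : Spec R) : Prop :=
  prime_lt p q /\ forall r : Spec R, ~ (prime_lt p r /\ prime_lt r q).

Definition saturated_chain (R : comNzRingType) (p q : Spec R) (n : nat)
    (c : nat -> Spec R) : Prop :=
  [/\ c 0 =i p, c n =i q & forall i, (i < n)%N -> covers (c i) (c i.+1)].

Definition catenary (R : comNzRingType) : Prop :=
  forall p q : Spec R, {subset p <= q} ->
  exists n, (exists c, saturated_chain p q n c) /\
            forall k c, saturated_chain p q k c -> k = n.

Definition universally_catenary (R : comNzRingType) : Prop :=
  forall (B : comNzRingType) (f : {rmorphism R -> B}),
  finite_type f -> catenary B.

(* [expanded_power f I n b] means that b lies in I^n B, for f : A -> B. *)
Definition expanded_power (A B : comNzRingType) (f : A -> B) (I : {pred A})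
    (n : nat) (b : B) : Prop :=
  exists k (c : 'I_k -> B) (a : 'I_k -> 'I_n -> A),
    (forall i j, a i j \in I) /\ b = \sum_i c i * f (\prod_j a i j).

(* [f : A -> B] is the m-adic completion of A, that is, A/m^n -> B/m^n B is an
   isomorphism for all n and B is the inverse limit of the rings B/m^n B. *)
Record is_completion (A B : comNzRingType) (m : {pred A})
    (f : {rmorphism A -> B}) : Prop := IsCompletion {
  completion_inj : forall n a,
    expanded_power f m n (f a) -> expanded_power idfun m n a;
  completion_surj : forall n b, exists a, expanded_power f m n (b - f a);
  completion_separated : forall b,
    (forall n, expanded_power f m n b) -> b = 0;
  completion_complete : forall u : nat -> B,
    (forall n, expanded_power f m n (u n.+1 - u n)) ->
    exists b, forall n, expanded_power f m n (b - u n)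
}.

(* T is the tensor product of the A-algebras B and C, i.e. their pushout in
   commutative rings.  Testing against nonzero rings D only is no restriction,
   the morphism to the zero ring being unique. *)
Definition is_tensor_product (A B C T : comNzRingType)
    (f : {rmorphism A -> B}) (g : {rmorphism A -> C})
    (i : {rmorphism B -> T}) (j : {rmorphism C -> T}) : Prop :=
  (forall a, i (f a) = j (g a)) /\
  forall (D : comNzRingType) (u : {rmorphism B -> D}) (v : {rmorphism C -> D}),
    (forall a, u (f a) = v (g a)) ->
  exists w : {rmorphism T -> D},
    [/\ forall b, w (i b) = u b, forall c, w (j c) = v c &
        forall w' : {rmorphism T -> D},
          (forall b, w' (i b) = u b) -> (forall c, w' (j c) = v c) -> w' =1 w].

(* If the tensor product over K is zero it has no model in [comNzRingType], and
   the condition holds, as it should: the zero ring is regular. *)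
Definition geometrically_regular (K : fieldType) (B : comNzRingType)
    (f : {rmorphism K -> B}) : Prop :=
  forall (L : fieldExtType K) (T : comNzRingType)
    (i : {rmorphism B -> T}) (j : {rmorphism L -> T}),
  is_tensor_product f (in_alg L) i j -> regular_ring T.

Definition geometrically_regular_formal_fibres (A : comNzRingType)
    (m : idealr A) : Prop :=
  forall (Ac : comNzRingType) (f : {rmorphism A -> Ac}), is_completion m f ->
  forall (q : Spec A) (F : comNzRingType)
    (i : {rmorphism Ac -> F}) (j : {rmorphism residue_field q -> F}),
  is_tensor_product f (to_residue_field q) i j -> geometrically_regular j.

Definition G_ring (R : comNzRingType) : Prop :=
  forall (p : Spec R) (m : idealr (localization p)),
  local_ring m -> geometrically_regular_formal_fibres m.

Definition J2 (R : comNzRingType) : Prop :=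
  forall (B : comNzRingType) (f : {rmorphism R -> B}), finite_type f ->
  exists J : {pred B}, ideal J /\
    forall q : Spec B, regular_local (localization q) <-> ~ V J q.

Definition excellent (R : comNzRingType) : Prop :=
  [/\ noetherian R, universally_catenary R, G_ring R & J2 R].

Module QuotientModule.
Section QuotientModule.
Variables (R : comNzRingType) (p : Spec R).

Definition type := {ideal_quot p}.
HB.instance Definition _ := GRing.ComNzRing.on type.

Definition scale (a : R) (x : type) : type := \pi_{ideal_quot p} a * x.

Lemma scaleA a b x : scale a (scale b x) = scale (a * b) x.
Proof. by rewrite /scale rmorphM mulrA. Qed.

Lemma scale1 : left_id 1 scale.
Proof. by move=> x; rewrite /scale rmorph1 mul1r. Qed.

Lemma scaleDr : right_distributive scale +%R.
Proof. by move=> a x y; rewrite /scale mulrDr. Qed.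

Lemma scaleDl x : {morph scale^~ x : a b / a + b}.
Proof. by move=> a b; rewrite /scale rmorphD mulrDl. Qed.

HB.instance Definition _ :=
  GRing.Zmodule_isLmodule.Build R type scaleA scale1 scaleDr scaleDl.

End QuotientModule.
End QuotientModule.
HB.export QuotientModule.

Definition quotient_module (R : comNzRingType) (p : Spec R) : lmodType R :=
  QuotientModule.type p.

Definition projective_module (R : comNzRingType) (P : lmodType R) : Prop :=
  forall (M N : lmodType R) (g : {linear M -> N}) (f : {linear P -> N}),
    (forall y, exists x, g x = y) ->
  exists h : {linear P -> M}, forall x, g (h x) = f x.

Definition injective_module (R : comNzRingType) (E : lmodType R) : Prop :=
  forall (M N : lmodType R) (g : {linear M -> N}) (f : {linear M -> E}),
    injective g ->
  exists h : {linear N -> E}, forall x, h (g x) = f x.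

Definition essential (R : comNzRingType) (N E : lmodType R)
    (i : {linear N -> E}) : Prop :=
  forall S : {pred E}, submod_closed S -> (exists2 y, y \in S & y != 0) ->
  exists2 x, i x \in S & i x != 0.

Definition injective_envelope (R : comNzRingType) (N E : lmodType R)
    (i : {linear N -> E}) : Prop :=
  [/\ injective i, essential i & injective_module E].

(* The resolution 0 -> P_n -> ... -> P_0 -> M -> 0 is extended by zero above n. *)
Definition projective_resolution (R : comNzRingType) (M : lmodType R) (n : nat)
    (P : nat -> lmodType R) (d : forall i, {linear P i.+1 -> P i})
    (e : {linear P 0 -> M}) : Prop :=
  [/\ forall i, projective_module (P i),
      forall i, (n < i)%N -> forall x : P i, x = 0,
      forall y, exists x, e x = y,
      forall x, e x = 0 <-> exists y, d 0 y = x &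
      forall i x, d i x = 0 <-> exists y, d i.+1 y = x].

Definition pd_le (R : comNzRingType) (M : lmodType R) (n : nat) : Prop :=
  exists (P : nat -> lmodType R) (d : forall i, {linear P i.+1 -> P i})
    (e : {linear P 0 -> M}), projective_resolution n d e.

Definition pd_infinite (R : comNzRingType) (M : lmodType R) : Prop :=
  forall n, ~ pd_le M n.

(* Main.v *)
From HB Require Import structures.
Require Import Defs.
From mathcomp Require Import all_boot all_order all_algebra.
From mathcomp Require Import ring boolp finmap.
From mathcomp.multinomials Require monalg.

(** If [E = E_R(R/p)] has a finite projective resolution [P], then [R_p] is
    Cohen-Macaulay; this contradicts [p] in [V(I)].

    Let [x_1, ..., x_r] be a maximal [R_p]-regular sequence and [J] the ideal it
    generates.  Since [E] is injective, [H_i(P / (x_1, ..., x_i) P)] localized at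
    [p] satisfies Baer's criterion over [R / (x_1, ..., x_i)], so it is divisible
    by [x_(i+1)]; hence [Tor_j(E, R/J)_p = 0] for [j <> r].

    Let [n] be maximal with [Tor_n(E, R/K)_p <> 0] for some ideal [K]; the functor
    [Tor_n(E, -)_p] is then left exact.  As [E] is [p]-torsion, so is
    [Tor_n(E, R/K)_p], and a maximal such [K] must be [p].  The maximality of the
    sequence gives an embedding of [R/p] into [R/J] at [p], so
    [Tor_n(E, R/J)_p <> 0] and [n = r].

    If some [y] in [p] were not nilpotent modulo [J] at [p], then for [L = (J : y^k)]
    with [k] large [y] is regular on [R/L], so [Tor_r(E, R/L)_p = 0] by torsion.
    But [Tor_r(E, R/J)_p -> Tor_r(E, R/p)_p] is onto, because [P/JP] splits below
    degree [r], and it factors through [Tor_r(E, R/L)_p]: a contradiction.  So [p]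
    is nilpotent modulo [J] at [p], and Krull's height theorem gives
    [dim R_p <= r <= depth R_p].

    Here "at [p]" is understood over [R] itself, as "up to a factor outside [p]". *)

Set Implicit Arguments.
Unset Strict Implicit.
Unset Printing Implicit Defensive.

Import GRing.Theory.
Local Open Scope ring_scope.
Local Open Scope quotient_scope.

(** * Linear identities in modules *)

Inductive module_expr (R : Type) :=
  | MAtom of nat
  | MZero
  | MAdd of module_expr R & module_expr R
  | MOpp of module_expr R
  | MScale of R & module_expr R.
Arguments MAtom {R}.
Arguments MZero {R}.

Section ModuleExpr.
Variables (R : comNzRingType) (M : lmodType R).

Fixpoint meval (env : seq M) (e : module_expr R) : M :=
  match e with
  | MAtom i => env`_i
  | MZero => 0
  | MAdd e f => meval env e + meval env f
  | MOpp e => - meval env e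
  | MScale a e => a *: meval env e
  end.

Fixpoint mcoef (n : nat) (e : module_expr R) : R :=
  match e with
  | MAtom i => if eqn i n then 1 else 0
  | MZero => 0
  | MAdd e f => mcoef n e + mcoef n f
  | MOpp e => - mcoef n e
  | MScale a e => a * mcoef n e
  end.

Lemma mevalE env e : meval env e = \sum_(n < size env) mcoef n e *: env`_n.
Proof.
elim: e => [i||e IHe f IHf|e IH|a e IH] /=.
- have [lti|lei] := ltnP i (size env); last first.
    rewrite nth_default // big1 // => n _; rewrite eqnE gtn_eqF ?scale0r //.
    exact: leq_trans lei.
  rewrite (bigD1 (Ordinal lti)) //= eqnE eqxx scale1r big1 ?addr0 // => n ni.
  by rewrite eq_sym (negPf (ni : (n : nat) != i)) scale0r.
- by rewrite big1 // => n _; rewrite scale0r.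
- by rewrite IHe IHf -big_split; apply: eq_bigr => n _; rewrite scalerDl.
- by rewrite IH -sumrN; apply: eq_bigr => n _; rewrite scaleNr.
- by rewrite IH scaler_sumr; apply: eq_bigr => n _; rewrite scalerA.
Qed.

Fixpoint mcoef_eq (k : nat) (e f : module_expr R) : Prop :=
  if k is k'.+1 then mcoef k' e = mcoef k' f /\ mcoef_eq k' e f else True.

(** Comparing coefficients atom by atom reduces a module identity to ring identities, which the
    tactic [module] passes to [ring]. *)
Lemma meval_eq env e f : mcoef_eq (size env) e f -> meval env e = meval env f.
Proof.
move=> ef; rewrite !mevalE; apply: eq_bigr => n _; congr (_ *: _).
elim: (size env) n ef => [[]//|k IH] n [efk /IH ef].
have [lt|] := ltnP n k; first exact: (ef (Ordinal lt)).
by move=> le; have -> : n = k :> nat by apply/eqP; rewrite eqn_leq le -ltnS ltn_ord.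
Qed.

End ModuleExpr.

Ltac module_atom v env :=
  let rec find l := lazymatch l with
    | v :: _ => constr:(O)
    | _ :: ?l' => let n := find l' in constr:(S n)
    end in find env.

Ltac module_atoms v env :=
  lazymatch v with
  | @Algebra.add _ ?a ?b => let env' := module_atoms a env in module_atoms b env'
  | @Algebra.opp _ ?a => module_atoms a env
  | @GRing.scale _ _ _ ?a => module_atoms a env
  | @Algebra.zero _ => env
  | _ => match env with
         | _ => let n := module_atom v env in env
         | _ => constr:(v :: env)
         end
  end.

Ltac module_quote R v env :=
  lazymatch v with
  | @Algebra.add _ ?a ?b =>
      let e := module_quote R a env in let f := module_quote R b env in
      constr:(MAdd e f)
  | @Algebra.opp _ ?a => let e := module_quote R a env in constr:(MOpp e)
  | @GRing.scale _ _ ?c ?a =>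
      let e := module_quote R a env in constr:(@MScale R c e)
  | @Algebra.zero _ => constr:(@MZero R)
  | _ => let n := module_atom v env in constr:(@MAtom R n)
  end.

Ltac module R :=
  lazymatch goal with
  | |- @eq ?M ?a ?b =>
      let env := module_atoms a (@nil M) in let env := module_atoms b env in
      let e := module_quote (GRing.ComNzRing.sort R) a env in
      let f := module_quote (GRing.ComNzRing.sort R) b env in
      apply: (@meval_eq R _ env e f); cbn [mcoef_eq mcoef size eqn]; repeat split; try ring
  end.

(** * Ideals, primes and Krull's height theorem *)

Definition subideal (R : Type) (J K : R -> Prop) : Prop := forall x, J x -> K x.

Section IdealTheory.
Variable R : comNzRingType.
Implicit Types J K p q : R -> Prop.

(** From here on ideals are [Prop]-valued predicates, and the unit ideal counts as one. *)
Definition is_ideal J : Prop :=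
  [/\ J 0, forall x y, J x -> J y -> J (x + y) & forall a x, J x -> J (a * x)].

Definition is_prime p : Prop :=
  [/\ is_ideal p, ~ p 1 & forall x y, p (x * y) -> p x \/ p y].

Definition adjoin J x : R -> Prop := fun u => exists j a, J j /\ u = j + a * x.

Definition colon J x : R -> Prop := fun a => J (a * x).

Definition saturated p J : Prop := forall s u, ~ p s -> J (s * u) -> J u.

(** For a prime [p], the contraction to [R] of the ideal generated by [J] in the localization at
    [p]; saturated ideals stand for ideals of that localization. *)
Definition saturation p J : R -> Prop := fun u => exists2 s, ~ p s & J (s * u).

Lemma idealDl J x y : is_ideal J -> J x -> J (x + y) -> J y.
Proof.
case=> _ JD JM Jx Jxy; have -> : y = (x + y) + (-1) * x by ring.
exact/JD/JM.
Qed.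

Lemma idealB J x y : is_ideal J -> J x -> J y -> J (x - y).
Proof. by case=> _ JD JM Jx Jy; rewrite -mulN1r; apply/JD/JM. Qed.

Lemma ideal_mulr J a x : is_ideal J -> J x -> J (x * a).
Proof. by case=> _ _ JM Jx; rewrite mulrC; apply: JM. Qed.

Lemma ideal_sum J (I : Type) (r : seq I) (P : pred I) (F : I -> R) :
  is_ideal J -> (forall i, P i -> J (F i)) -> J (\sum_(i <- r | P i) F i).
Proof. by move=> [J0 JD _] JF; apply: big_ind. Qed.

Lemma prime_mul_notin p s t : is_prime p -> ~ p s -> ~ p t -> ~ p (s * t).
Proof. by case=> _ _ pM ps pt /pM[]. Qed.

Lemma prime_exp p x k : is_prime p -> p (x ^+ k) -> p x.
Proof.
case=> _ p1 pM; elim: k => [|k IH]; first by rewrite expr0.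
by rewrite exprS => /pM[].
Qed.

Lemma zero_ideal : is_ideal (fun x => x = 0).
Proof.
by split=> // [x y -> ->|a x ->]; rewrite ?addr0 ?mulr0.
Qed.

Lemma adjoin_ideal J x : is_ideal J -> is_ideal (adjoin J x).
Proof.
move=> [J0 JD JM]; split.
- by exists 0, 0; rewrite mul0r addr0.
- move=> _ _ [j [a [Jj ->]]] [k [b [Jk ->]]]; exists (j + k), (a + b).
  by split; [exact: JD | ring].
- move=> c _ [j [a [Jj ->]]]; exists (c * j), (c * a).
  by split; [exact: JM | ring].
Qed.

Lemma sub_adjoin J x : subideal J (adjoin J x).
Proof. by move=> u Ju; exists u, 0; rewrite mul0r addr0. Qed.

Lemma adjoin_mem J x a : is_ideal J -> adjoin J x (a * x).
Proof. by case=> J0 _ _; exists 0, a; rewrite add0r. Qed.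

Lemma adjoin_mem1 J x : is_ideal J -> adjoin J x x.
Proof. by move=> JI; rewrite -{2}[x]mul1r; apply: adjoin_mem. Qed.

Lemma adjoin_sub J K x :
  is_ideal K -> subideal J K -> K x -> subideal (adjoin J x) K.
Proof. by move=> [_ KD KM] JK Kx _ [j [a [Jj ->]]]; apply/KD/KM/Kx/JK. Qed.

Lemma colon_ideal J x : is_ideal J -> is_ideal (colon J x).
Proof.
move=> [J0 JD JM]; rewrite /colon; split; first by rewrite mul0r.
- by move=> u v Ju Jv; rewrite mulrDl; apply: JD.
- by move=> a u Ju; rewrite -mulrA; apply: JM.
Qed.

Lemma sub_colon J x : is_ideal J -> subideal J (colon J x).
Proof. by move=> JI u Ju; apply: ideal_mulr. Qed.

Lemma saturation_ideal p J : is_prime p -> is_ideal J -> is_ideal (saturation p J).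
Proof.
move=> pP [J0 JD JM]; have [_ p1 _] := pP; split.
- by exists 1 => //; rewrite mulr0.
- move=> x y [s ps Jsx] [t pt Jty]; exists (s * t); first exact: prime_mul_notin.
  have -> : s * t * (x + y) = t * (s * x) + s * (t * y) by ring.
  by apply: JD; apply: JM.
- by move=> a x [s ps Jsx]; exists s => //; rewrite mulrCA; apply: JM.
Qed.

Lemma sub_saturation p J : is_prime p -> subideal J (saturation p J).
Proof. by case=> _ p1 _ u Ju; exists 1; rewrite ?mul1r. Qed.

Lemma saturation_saturated p J : is_prime p -> saturated p (saturation p J).
Proof.
move=> pP s u ps [t pt Jtsu]; exists (t * s); first exact: prime_mul_notin.
by rewrite -mulrA.
Qed.

Lemma saturation_sub p J K :
  saturated p K -> subideal J K -> subideal (saturation p J) K.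
Proof. by move=> Ks JK u [s ps /JK]; apply: Ks. Qed.

Lemma colon_saturated p J x : saturated p J -> saturated p (colon J x).
Proof. by move=> Js s u ps; rewrite /colon -mulrA => /Js; apply. Qed.

Lemma saturated_proper p J : is_ideal J -> saturated p J -> ~ J 1 -> subideal J p.
Proof.
move=> JI Js J1 u Ju; apply: contrapT => pu; apply: J1.
by apply: (Js u) => //; rewrite mulr1.
Qed.

Lemma generated_by_ideal (s : seq R) : is_ideal (generated_by s).
Proof.
split; first by exists (fun=> 0); rewrite big1 // => i; rewrite mul0r.
- move=> _ _ [c ->] [d ->]; exists (fun i => c i + d i).
  by rewrite -big_split; apply: eq_bigr => i _; rewrite mulrDl.
- move=> a _ [c ->]; exists (fun i => a * c i).
  by rewrite mulr_sumr; apply: eq_bigr => i _; rewrite mulrA.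
Qed.

Lemma generated_by_mem (s : seq R) x : x \in s -> generated_by s x.
Proof.
move=> /(nthP 0)[i lti <-]; exists (fun j => (j == Ordinal lti)%:R).
rewrite (bigD1 (Ordinal lti)) //= eqxx mul1r big1 ?addr0 // => j /negPf->.
by rewrite mul0r.
Qed.

Lemma generated_by_sub (s : seq R) J :
  is_ideal J -> (forall x, x \in s -> J x) -> subideal (generated_by s) J.
Proof.
move=> JI sJ _ [c ->]; apply: ideal_sum => // i _.
by have [_ _ JM] := JI; apply/JM/sJ/mem_nth.
Qed.

Lemma noetherian_fg : noetherian R -> forall J, is_ideal J ->
  exists s, forall x, J x <-> generated_by s x.
Proof.
move=> noeR J [J0 JD JM]; have [|s sP] := noeR [pred x | `[< J x >]].
  split; first by rewrite inE; apply/asboolP.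
  by move=> a x y /asboolP Jx /asboolP Jy; apply/asboolP/JD => //; apply: JM.
by exists s => x; rewrite -sP inE; split=> /asboolP.
Qed.

(** Otherwise choice yields a strictly ascending sequence above [J0]; its union is finitely
    generated, so some member already contains the generators. *)
Lemma noetherian_maximal (F : (R -> Prop) -> Prop) J0 :
  noetherian R -> (forall J, F J -> is_ideal J) -> F J0 ->
  exists J, [/\ F J, subideal J0 J & forall K, F K -> subideal J K -> subideal K J].
Proof.
move=> noeR FI FJ0; apply: contrapT => noJ.
pose T := {J | F J /\ subideal J0 J}.
have step (J : T) : exists K : T, subideal (sval J) (sval K) /\
    ~ subideal (sval K) (sval J).
  case: J => J [FJ J0J] /=; apply: contrapT => noK; apply: noJ.
  exists J; split=> // K FK JK; apply: contrapT => KJ; apply: noK.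
  have J0K : subideal J0 K by move=> x /J0J /JK.
  by exists (exist _ K (conj FK J0K)).
have [next nextP] := choice step.
have J00 : subideal J0 J0 by [].
pose t n := iter n next (exist _ J0 (conj FJ0 J00)); pose c n := sval (t n).
have cS n : subideal (c n) (c n.+1) by have [] := nextP (t n).
have cN n : ~ subideal (c n.+1) (c n) by have [] := nextP (t n).
have cle n k : subideal (c n) (c (k + n)%N).
  by elim: k => // k IH x /IH; rewrite addSn; apply: cS.
have cI n : is_ideal (c n) by apply: FI; rewrite /c; case: (t n) => ? [].
pose U x := exists n, c n x.
have UI : is_ideal U.
  split; first by exists 0%N; have [] := cI 0%N.
  - move=> x y [n cx] [k cy]; exists (k + n)%N; have [_ cD _] := cI (k + n)%N.
    by apply: cD; [exact: cle | rewrite addnC; exact: cle].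
  - by move=> a x [n cx]; exists n; have [_ _ cM] := cI n; apply: cM.
have [s sP] := noetherian_fg noeR UI.
have [N sN] : exists N, forall x, x \in s -> c N x.
  have sU x : x \in s -> U x by move=> xs; apply/sP/generated_by_mem.
  elim: (s) sU => [|a r IH] sU; first by exists 0%N.
  have [|N rN] := IH; first by move=> x xr; apply: sU; rewrite inE xr orbT.
  have [k ca] := sU a (mem_head _ _); exists (k + N)%N => x.
  rewrite inE => /orP[/eqP->|/rN]; [rewrite addnC|]; exact: cle.
apply: (cN N) => x cx; apply: generated_by_sub (cI N) sN _ _.
by apply/sP; exists N.+1.
Qed.

(* A maximal ideal among those avoiding a multiplicative set is prime. *)
Lemma prime_avoiding J (S : R -> Prop) :
  noetherian R -> is_ideal J -> S 1 -> (forall x y, S x -> S y -> S (x * y)) ->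
  (forall x, S x -> ~ J x) ->
  exists q, [/\ is_prime q, subideal J q & forall x, S x -> ~ q x].
Proof.
move=> noeR JI S1 SM JS.
pose F K := is_ideal K /\ forall x, S x -> ~ K x.
have [| |q [[qI qS] Jq qmax]] := @noetherian_maximal F J noeR.
- by move=> K [].
- by split.
exists q; split=> //; split; [by []|exact: qS|] => x y qxy.
have meets z : ~ q z -> exists2 t, S t & adjoin q z t.
  move=> qz; apply: contrapT => nt; apply: qz; apply: (qmax (adjoin q z)).
  - split; first exact: adjoin_ideal.
    by move=> t St qt; apply: nt; exists t.
  - exact: sub_adjoin.
  - exact: adjoin_mem1.
have [qx|qx] := pselect (q x); first by left.
have [qy|qy] := pselect (q y); first by right.
have [t St [j [a [qj et]]]] := meets x qx.
have [u Su [k [b [qk eu]]]] := meets y qy.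
case: (qS _ (SM _ _ St Su)); rewrite et eu; case: qI => _ qD qM.
have -> : (j + a * x) * (k + b * y) = (k + b * y) * j + (a * x * k + a * b * (x * y)) by ring.
by apply: (qD); [apply: qM | apply: qD; apply: qM].
Qed.


(** * Nakayama and the artinian property, localized at a prime *)

(** The case [M = N + x M] at [c]. A saturated [K] maximal among those between [N] and [M] and
    different from [M] contains [x M], hence [M]. *)
Lemma nakayama c x (M N : R -> Prop) :
  noetherian R -> is_prime c -> c x -> is_ideal M -> saturated c M ->
  is_ideal N -> saturated c N -> subideal N M ->
  (forall u, M u -> exists s e, [/\ ~ c s, M e & N (s * u - x * e)]) ->
  subideal M N.
Proof.
move=> noeR cP cx MI Ms NI Ns NM MN; apply: contrapT => nMN.
pose F K := [/\ is_ideal K, saturated c K, subideal N K, subideal K M & ~ subideal M K].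
have [| |K [[KI Ks NK KM nMK] _ Kmax]] := @noetherian_maximal F N noeR.
- by move=> K [].
- by split.
have [_ KD KMl] := KI; have [_ MD MMl] := MI.
suff xM u : M u -> K (x * u).
  apply: nMK => u /MN[s [e [cs Me /NK Ksu]]]; apply: (Ks s) => //.
  by rewrite -[s * u](subrK (x * e)); apply: KD => //; apply: xM.
move=> Mu; apply: contrapT => Kxu; apply: (Kxu); apply: KMl.
pose K' := saturation c (adjoin K (x * u)).
have KK' : subideal K K' by move=> v /(@sub_adjoin _ (x * u)); apply: sub_saturation.
have [s cs [k [a [Kk su]]]] : K' u.
  apply: contrapT => K'u; apply: Kxu; apply: (Kmax K') => //.
    split.
    - exact/saturation_ideal/adjoin_ideal.
    - exact: saturation_saturated.
    - by move=> v /NK /KK'.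
    - by apply: saturation_sub => //; apply: adjoin_sub => //; apply: MMl.
    - by move=> MK'; apply/K'u/MK'.
  exact/sub_saturation/adjoin_mem1.
(* Since [x] lies in [c] and [s] does not, [s - a * x] is outside [c]. *)
apply: (Ks (s - a * x)).
  move=> csax; apply: cs; have [[_ cD cM] _ _] := cP.
  by rewrite -[s](subrK (a * x)); apply: cD => //; apply: cM.
have -> : (s - a * x) * u = s * u - a * (x * u) by ring.
by rewrite su addrK.
Qed.

(** Choose [y] outside [J] with [colon J y] maximal. If [u * y] were outside [J], its colon ideal
    would be no larger, so from [u ^+ n * y] in [J] the exponent could be lowered to 0. *)
Lemma artinian_socle c J :
  noetherian R -> is_prime c -> is_ideal J -> saturated c J -> ~ J 1 ->
  (forall u, c u -> exists k, J (u ^+ k)) ->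
  exists2 y, ~ J y & forall u, c u -> J (u * y).
Proof.
move=> noeR cP JI Js J1 Jnil.
pose F K := exists2 y, ~ J y & K = colon J y.
have [| |_ [[y Jy ->] _ Kmax]] := @noetherian_maximal F (colon J 1) noeR.
- by move=> _ [y _ ->]; apply: colon_ideal.
- by exists 1.
exists y => // u /Jnil[k]; elim: k => [/J1 //|k IH Juk].
apply: contrapT => Juy; apply: Juy.
have [Jk|Jk] := pselect (J (u ^+ k)); first exact: IH.
have [Juy|Juy] := pselect (J (u * y)); first by [].
have colon_uy : subideal (colon J (u * y)) (colon J y).
  apply: Kmax; first by exists (u * y).
  move=> v; rewrite /colon => Jvy; rewrite mulrCA.
  by have [_ _ JM] := JI; apply: JM.
elim: {Juk Jk IH} k.+1 (ideal_mulr y JI Juk) => [|n IH].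
  by rewrite expr0 mul1r => /Jy.
move=> Jn; apply: IH; apply: (colon_uy (u ^+ n)).
by rewrite /colon mulrA -exprSr.
Qed.

(** Noetherian induction: a maximal counterexample [K] has a socle element [y], and the condition
    holds above [K + (y)], one simple step above [K] at [c]. *)
Lemma artinian_dcc c J :
  noetherian R -> is_prime c -> is_ideal J -> saturated c J ->
  (forall u, c u -> exists k, J (u ^+ k)) ->
  forall I : nat -> R -> Prop,
  (forall n, [/\ is_ideal (I n), saturated c (I n), subideal J (I n)
               & subideal (I n.+1) (I n)]) ->
  exists N, forall n, (N <= n)%N -> subideal (I n) (I n.+1).
Proof.
move=> noeR cP JI Js Jnil; apply: contrapT => nQ.
pose Q J := forall I : nat -> R -> Prop,
  (forall n, [/\ is_ideal (I n), saturated c (I n), subideal J (I n)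
               & subideal (I n.+1) (I n)]) ->
  exists N, forall n, (N <= n)%N -> subideal (I n) (I n.+1).
pose F K := [/\ is_ideal K, saturated c K, subideal J K & ~ Q K].
have [| |K [[KI Ks JK nQK] _ Kmax]] := @noetherian_maximal F J noeR.
- by move=> K [].
- by split.
apply: nQK => I IP.
have [K1|K1] := pselect (K 1).
  exists 0%N => n _ u _; have [_ _ KIn _] := IP n.+1; apply: KIn.
  by rewrite -[u]mulr1; have [_ _ KM] := KI; apply: KM.
have [|y Ky cy] := artinian_socle noeR cP KI Ks K1.
  by move=> u /Jnil[k /JK Kk]; exists k.
pose K' := saturation c (adjoin K y).
have KK' : subideal K K' by move=> v /(@sub_adjoin _ y); apply: sub_saturation.
have K'y : K' y by apply/sub_saturation/adjoin_mem1.
have K'I : is_ideal K' by apply/saturation_ideal/adjoin_ideal.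
have QK' : Q K'.
  apply: contrapT => nQK'; apply: Ky; apply: (Kmax K') => //; split=> //.
  - exact: saturation_saturated.
  - by move=> u /JK /KK'.
have Ile n k : subideal (I (k + n)%N) (I n).
  by elim: k => // k IH u Iu; apply: IH; have [_ _ _] := IP (k + n)%N; apply.
(* If every [I n] contains [y], the sequence lies above [K']. Otherwise [y] is missing from some
   [I N0], and the sums [I n + K'] become stationary. *)
have [Iy|/existsNP[N0 Iy]] := pselect (forall n, I n y).
  apply: QK' => n; have [InI Ins KIn InS] := IP n; split=> //.
  by apply: saturation_sub => //; apply: adjoin_sub.
pose I' n := saturation c (fun u => exists v w, [/\ I n v, K' w & u = v + w]).
have [n|N1 I'N1] := QK' I'.
  have [InI Ins KIn InS] := IP n; have [I0 ID IM] := InI; have [K0 KD KM] := K'I.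
  split.
  - apply: saturation_ideal => //; split.
    + by exists 0, 0; rewrite addr0.
    + move=> _ _ [v [w [Iv Kw ->]]] [v' [w' [Iv' Kw' ->]]].
      by exists (v + v'), (w + w'); split; [exact: ID | exact: KD | rewrite addrACA].
    + move=> a _ [v [w [Iv Kw ->]]].
      by exists (a * v), (a * w); split; [exact: IM | exact: KM | rewrite mulrDr].
  - exact: saturation_saturated.
  - by move=> w Kw; apply: sub_saturation => //; exists 0, w; rewrite add0r.
  - move=> u [s cs [v [w [Iv Kw e]]]]; exists s => //; exists v, w; split=> //.
    exact: InS.
exists (maxn N0 N1) => n; rewrite geq_max => /andP[leN0 leN1] u Iu.
have [InI Ins KIn InS] := IP n; have [ISI ISs KIS _] := IP n.+1.
have nIy : ~ I n y by rewrite -(subnK leN0) => /Ile.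
have [|s cs [v [w [Iv [t ct [j [a [Kj tw]]]] su]]]] := I'N1 n leN1 u.
  have [K0 _ _] := K'I.
  by apply: sub_saturation => //; exists u, 0; rewrite addr0.
have tsu : t * s * u = t * v + j + a * y by rewrite -mulrA su mulrDr tw addrA.
have [_ ID IM] := InI; have [_ ISD ISM] := ISI.
apply: (ISs (t * s)); first exact: prime_mul_notin.
rewrite tsu; apply: (ISD); first by apply: ISD; [exact: ISM | exact: KIS].
(* For [a] in [c], [a * y] lies in [K]; otherwise [a] is a unit at [c] and [y] would lie in
   [I n]. *)
have [ca|ca] := pselect (c a); first exact/KIS/cy.
case: nIy; apply: (Ins a) => //.
have -> : a * y = t * s * u - (t * v + j) by rewrite tsu addrAC subrr add0r.
apply: idealB => //; first exact: IM.
by apply: ID; [apply: IM; exact: InS | exact: KIn].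
Qed.

(* Krull's principal ideal theorem, applied to [R / a] localized at [c]; the
   ideals [D n] replace the symbolic powers of [b]. *)
Lemma prime_between a b c x :
  noetherian R -> is_prime a -> is_prime b -> is_prime c ->
  subideal a b -> ~ subideal b a -> subideal b c -> ~ subideal c b -> c x ->
  exists d, [/\ is_prime d, d x, subideal a d & ~ subideal d a] /\
            (subideal d c /\ ~ subideal c d).
Proof.
move=> noeR aP bP cP ab nba bc ncb cx.
have [bx|bx] := pselect (b x); first by exists b.
apply: contrapT => nd.
have [aI a1 aM] := aP; have [bI b1 bM] := bP; have [cI c1 cM] := cP.
have xaI := adjoin_ideal x aI.
pose J := saturation c (adjoin a x).
(* By the negated conclusion no prime strictly inside [c] contains [a] and [x], so [c] is nilpotent
   modulo [J]. *)
have Jnil u : c u -> exists k, J (u ^+ k).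
  move=> cu; apply: contrapT => nk; apply: nd.
  pose S z := exists s k, ~ c s /\ z = s * u ^+ k.
  have [| | |d [dP ad dS]] := @prime_avoiding (adjoin a x) S noeR xaI.
  - by exists 1, 0%N; rewrite expr0 mulr1.
  - move=> _ _ [s [k [cs ->]]] [t [l [ct ->]]]; exists (s * t), (k + l)%N.
    by split; [exact: prime_mul_notin | rewrite mulrACA -exprD].
  - by move=> _ [s [k [cs ->]]] ask; apply: nk; exists k, s.
  have dx : d x by apply/ad/adjoin_mem1.
  exists d; split; first split=> //.
  - by move=> v av; apply/ad/sub_adjoin.
  - by move=> /(_ _ dx) /ab.
  split=> [v dv|cd]; last first.
    by apply: (dS u); [exists 1, 1%N; rewrite mul1r expr1 | exact: cd].
  apply: contrapT => cv; apply: (dS v) => //.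
  by exists v, 0%N; rewrite expr0 mulr1.
have [y /not_implyP[yb ya]] : exists y, ~ (b y -> a y) by apply/existsNP.
pose D n := saturation b (adjoin a (y ^+ n)).
have DI n : is_ideal (D n) by apply/saturation_ideal/adjoin_ideal.
have Ds n : saturated c (D n).
  by move=> s u cs; apply: saturation_saturated => // /bc.
have DS n : subideal (D n.+1) (D n).
  apply: saturation_sub; first exact: saturation_saturated.
  apply: adjoin_sub => //; first by move=> u au; apply/sub_saturation/sub_adjoin.
  by apply: sub_saturation => //; rewrite exprS; apply: adjoin_mem.
(* The chain condition above [J] makes the [D n] stationary after [x] is added; Nakayama then
   removes [x]. *)
pose I n := saturation c (fun u => exists d e, D n d /\ u = d + e * x).
have II n : is_ideal (I n) by apply/saturation_ideal/(adjoin_ideal x (DI n)).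
have [n|N IN] := artinian_dcc noeR cP (saturation_ideal cP xaI)
    (@saturation_saturated c _ cP) Jnil (I := I).
  split=> //.
  - exact: saturation_saturated.
  - apply: saturation_sub; first exact: saturation_saturated.
    apply: adjoin_sub => //.
      move=> u au; apply: sub_saturation => //.
      by exists u, 0; rewrite mul0r addr0; split=> //; apply/sub_saturation/sub_adjoin.
    by apply: sub_saturation => //; apply: adjoin_mem1.
  - move=> u [s cs [d [e [Dd su]]]]; exists s => //; exists d, e; split=> //.
    exact: DS.
have DN : subideal (D N) (D N.+1).
  apply: (@nakayama c x) => // u Du.
  have [|s cs [d [e [Dd su]]]] := IN N (leqnn N) u.
    by apply: sub_saturation => //; exists u, 0; rewrite mul0r addr0.
  exists s, e; split=> //; last by rewrite su [x * e]mulrC addrK.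
  (* [x] is outside [b] and [D N] is saturated at [b], so [x * e] in [D N] gives [e] in [D N]. *)
  apply: (@saturation_saturated b _ bP x) => //.
  have -> : x * e = s * u - d by rewrite su addrAC subrr add0r mulrC.
  by apply: (idealB (DI N)); [have [_ _ DM] := DI N; apply: DM | exact: DS].
have [|s bs [j [f [aj sy]]]] := DN (y ^+ N).
  by apply: sub_saturation => //; apply: adjoin_mem1.
(* [y] is outside [a], so [s - f * y] is in [a]; as [y] is in [b], this puts [s] in [b]. *)
have /aM[/(prime_exp aP) //|asf] : a (y ^+ N * (s - f * y)).
  suff -> : y ^+ N * (s - f * y) = j by [].
  by rewrite mulrBr mulrC sy exprS; ring.
apply: bs; rewrite -[s](subrK (f * y)); have [_ bD bMl] := bI.
by apply: bD; [exact: ab | exact: bMl].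
Qed.


(** * Chains of primes and the height theorem *)

(** The length counts strict inclusions, and the recursion peels off the top [c]; at length 0 the
    two ends have the same elements. *)
Fixpoint chain l (a c : R -> Prop) : Prop :=
  if l is l'.+1 then exists b, [/\ is_prime b, chain l' a b, subideal b c & ~ subideal c b]
  else subideal a c /\ subideal c a.

Lemma chain_sub l a c : chain l a c -> subideal a c.
Proof.
elim: l c => [c []|l IH c [b [_ /IH ab bc _]]] //.
by move=> x /ab /bc.
Qed.

(** [prime_between] replaces the prime below the top by one containing [x], and the exchange is
    repeated downwards; the lowest inclusion is given up. *)
Lemma chain_shift l a c x :
  noetherian R -> is_prime a -> is_prime c -> c x -> chain l.+1 a c ->
  exists d, [/\ is_prime d, subideal a d, d x & chain l d c].
Proof.
move=> noeR aP; elim: l c => [|l IH] c cP cx.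
  move=> [b [_ [ab _] bc _]]; exists c; do !split=> //.
  by move=> u /ab /bc.
move=> [b [bP [b' [b'P ab' b'b nbb']] bc ncb]].
have [d [[dP dx b'd ndb'] [dc ncd]]] := prime_between noeR b'P bP cP b'b nbb' bc ncb cx.
have [|d0 [d0P ad0 d0x d0d]] := IH d dP dx; first by exists b'.
by exists d0; split=> //; exists d.
Qed.

(** The head of [xs] is adjoined last, so that a regular sequence grows at its front. *)
Definition span_over a (xs : seq R) : R -> Prop :=
  foldr (fun x J => adjoin J x) a xs.

Lemma span_over_ideal a xs : is_ideal a -> is_ideal (span_over a xs).
Proof. by move=> aI; elim: xs => //= x xs IH; apply: adjoin_ideal. Qed.

Lemma span_over_sub a b xs :
  is_ideal b -> subideal a b -> (forall x, x \in xs -> b x) ->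
  subideal (span_over a xs) b.
Proof.
move=> bI ab; elim: xs => //= x xs IH xsb; apply: adjoin_sub => //.
  by apply: IH => y xsy; apply: xsb; rewrite inE xsy orbT.
by apply: xsb; rewrite mem_head.
Qed.

Lemma sub_span_over a xs : subideal a (span_over a xs).
Proof. by elim: xs => //= x xs IH u /IH; apply: sub_adjoin. Qed.

Lemma span_over_mem a xs x : is_ideal a -> x \in xs -> span_over a xs x.
Proof.
move=> aI; elim: xs => //= y xs IH; rewrite inE => /orP[/eqP->|/IH].
  exact/adjoin_mem1/span_over_ideal.
exact: sub_adjoin.
Qed.

Definition ideal_span (xs : seq R) : R -> Prop := span_over (fun u => u = 0) xs.

Lemma ideal_span_is_ideal xs : is_ideal (ideal_span xs).
Proof. exact/span_over_ideal/zero_ideal. Qed.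

(** Induction on [xs]: [chain_shift] raises the bottom of the chain to a prime [d] containing [x],
    at the cost of one inclusion, and [d] absorbs [x]. *)
Theorem krull_height (p a c : R -> Prop) xs l :
  noetherian R -> is_prime p -> is_prime a -> subideal c p -> chain l a c ->
  (forall x, x \in xs -> p x) ->
  (forall y, p y -> exists k, saturation p (span_over a xs) (y ^+ k)) ->
  (l <= size xs)%N.
Proof.
move=> noeR pP aP cp; elim: xs a l c aP cp => [|x xs IH] a [|l] c aP cp // ac xsp pnil.
  case: ac => b [bP /chain_sub ab bc ncb]; case: ncb => y /cp py.
  have [k [s ps /= asy]] := pnil y py; apply: (ab).
  apply: (@prime_exp _ y k aP); have [_ _ /(_ _ _ asy)[as_|//]] := aP.
  by case: ps; apply/cp/bc/ab.
(* The top [c] is first replaced by [p], which is known to contain [x]. *)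
have [|d [dP ad dx dc]] := @chain_shift l a p x noeR aP pP (xsp x (mem_head _ _)).
  case: ac => b [bP ab bc ncb]; exists b; split=> // [u /bc /cp //|pb].
  by apply: ncb => u /cp /pb.
apply: (IH d l p) => // [y xsy|y py]; first by apply: xsp; rewrite inE xsy orbT.
have [k [s ps axy]] := pnil y py; exists k, s => //.
have [dI _ _] := dP; apply: (adjoin_sub _ _ _ axy); first exact: span_over_ideal.
  apply: span_over_sub; first exact: span_over_ideal.
    by move=> u /ad; apply: sub_span_over.
  by move=> z; apply: span_over_mem.
exact: sub_span_over.
Qed.

(** * Prime avoidance and the existence of regular elements *)

Lemma common_multiple (S : R -> Prop) (T : eqType) (bs : seq T) (Q : T -> R -> Prop) :
  S 1 -> (forall s t, S s -> S t -> S (s * t)) ->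
  (forall b s t, Q b s -> Q b (t * s)) ->
  (forall b, b \in bs -> exists2 s, S s & Q b s) ->
  exists2 s, S s & forall b, b \in bs -> Q b s.
Proof.
move=> S1 SM QM; elim: bs => [|b bs IH] Qbs; first by exists 1.
have [c bsc|s Ss Qs] := IH; first by apply: Qbs; rewrite inE bsc orbT.
have [t St Qt] := Qbs b (mem_head _ _); exists (s * t); first exact: SM.
by move=> c; rewrite inE => /orP[/eqP->|/Qs Qcs]; [|rewrite mulrC]; apply: QM.
Qed.

Lemma prime_avoidance (T : eqType) (p : R -> Prop) (q : T -> R -> Prop) (L : seq T) :
  is_ideal p -> (forall i, i \in L -> is_prime (q i)) ->
  (forall i j, i \in L -> j \in L -> subideal (q i) (q j) -> subideal (q j) (q i)) ->
  (forall i, i \in L -> exists2 u, p u & ~ q i u) ->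
  exists2 x, p x & forall i, i \in L -> ~ q i x.
Proof.
move=> pI; have [p0 pD pM] := pI; elim: L => [|i L IH] qP qinc pq; first by exists 0.
have inL j : j \in L -> j \in i :: L by rewrite inE orbC => ->.
have [j /inL/qP //|j k /inL jL /inL kL|j /inL/pq //|x px qx] := IH.
  exact: qinc.
have iL := mem_head i L; have qiP := qP i iL; have [[qi0 qiD qiM] qi1 qiM'] := qiP.
have [qix|qix] := pselect (q i x); last first.
  by exists x => // j; rewrite inE => /orP[/eqP->|/qx].
have [|j s t qjs jL|j jL|z qiz qz] := @common_multiple (fun z => ~ q i z) _ L
    (fun j z => j \in L -> q j z) qi1.
- by move=> s t; apply: prime_mul_notin.
- by have [[_ _ qM] _ _] := qP j (inL j jL); apply/qM/qjs.
(* Otherwise [q j] would be inside [q i], hence equal to it, and would contain [x]. *)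
- apply: contrapT => nz; apply: (qx j jL).
  apply: (qinc j i (inL j jL) iL) => // u qju.
  by apply: contrapT => qiu; apply: nz; exists u.
(* [y * z] is outside [q i] and inside every other [q j], so adding it to [x] changes the situation
   at [q i] only. *)
have [y py qiy] := pq i iL; exists (x + y * z).
  by apply: pD => //; rewrite mulrC; apply: pM.
move=> j; rewrite inE => /orP[/eqP->|jL] qxyz.
  by have /qiM'[] : q i (y * z) by apply: idealDl qxyz.
have [[qj0 qjD qjM] _ _] := qP j (inL j jL).
have qjyz : q j (y * z) by apply: qjM; apply: qz.
by apply: (qx j jL); apply: (idealDl _ qjyz); rewrite // addrC.
Qed.

(** [x] acts injectively on [R / J] localized at [p]. *)
Definition regular_modulo (p J : R -> Prop) x : Prop := subideal (colon J x) (saturation p J).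

Lemma colon_maximal_prime J y : is_ideal J -> ~ J y ->
  (forall z, ~ J z -> subideal (colon J y) (colon J z) -> subideal (colon J z) (colon J y)) ->
  is_prime (colon J y).
Proof.
move=> JI Jy ymax; split; first exact: colon_ideal.
  by rewrite /colon mul1r.
move=> a b; rewrite /colon => Jaby.
have [Jay|Jay] := pselect (J (a * y)); [by left | right].
apply: (ymax (a * y)) => //; last by rewrite /colon mulrCA mulrA.
by move=> u Ju; rewrite /colon mulrCA; have [_ _ JM] := JI; apply: JM.
Qed.

(* The annihilators of elements of [R / J] that are maximal among such
   annihilators are finitely many primes, and they contain all zero divisors. *)
Lemma regular_or_socle_saturated p J :
  noetherian R -> is_ideal p -> is_ideal J ->
  (forall y, ~ J y -> exists2 u, p u & ~ J (u * y)) ->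
  exists2 x, p x & subideal (colon J x) J.
Proof.
move=> noeR pI JI nsocle.
pose mx y := ~ J y /\ forall z, ~ J z ->
  subideal (colon J y) (colon J z) -> subideal (colon J z) (colon J y).
have mxP y : mx y -> is_prime (colon J y) by case; apply: colon_maximal_prime.
pose F K := exists2 L : seq R, (forall y, y \in L -> mx y) & K = span_over J L.
have [| |_ [[L Lmx ->] _ Lmax]] := @noetherian_maximal F J noeR.
- by move=> _ [L _ ->]; apply: span_over_ideal.
- by exists [::].
have mxL y : mx y -> span_over J L y.
  move=> yM; apply: (Lmax (span_over J (y :: L))).
  - by exists (y :: L) => // z; rewrite inE => /orP[/eqP->|/Lmx].
  - exact: sub_adjoin.
  - by apply: span_over_mem; rewrite ?mem_head.
(* [y] lies in the span of [L], so whatever lies in every [colon J z] lies in [colon J y]; being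
   prime, the latter contains one of them. *)
have colonL y : mx y -> exists2 z, z \in L & subideal (colon J z) (colon J y).
  move=> yM; apply: contrapT => nz; have [_ q1 _] := mxP y yM.
  have [|z s t Jz|z zL|u qu uL] := @common_multiple (fun u => ~ colon J y u) _ L
      (fun z u => colon J z u) q1.
  - by move=> s t; apply: prime_mul_notin; apply: mxP.
  - by have [_ _ JM] := colon_ideal z JI; apply: JM.
  - apply: contrapT => nu; apply: nz; exists z => // v Jv.
    by apply: contrapT => nyv; apply: nu; exists v.
  apply: qu; rewrite /colon mulrC.
  apply: (@span_over_sub J (colon J u) L) (mxL y yM).
  - exact: colon_ideal.
  - exact: sub_colon.
  - by move=> z /uL; rewrite /colon mulrC.
have [y /Lmx yM|y z /Lmx[Jy ymax] /Lmx[Jz _]|y /Lmx[Jy _]|x px xL] :=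
    @prime_avoidance _ p (colon J) L pI.
- exact: mxP.
- exact: ymax.
- exact: nsocle.
exists x => // y Jyx; apply: contrapT => Jy.
pose G K := exists2 z, ~ J z & K = colon J z.
have [| |_ [[z Jz ->] yz zmax]] := @noetherian_maximal G (colon J y) noeR.
- by move=> _ [z _ ->]; apply: colon_ideal.
- by exists y.
have zM : mx z by split=> // t Jt; apply: zmax; exists t.
have [t tL tz] := colonL z zM; apply: (xL t tL).
have [Jt tmax] := Lmx t tL; apply: (tmax z) => //; apply: yz.
by rewrite /colon mulrC.
Qed.

(** The second alternative embeds [R / p] into [R / J] at [p]; it is where a regular sequence
    stops. *)
Lemma regular_or_socle p J : noetherian R -> is_prime p -> is_ideal J ->
  (exists2 x, p x & regular_modulo p J x) \/
  (exists2 y, ~ saturation p J y & forall u, p u -> saturation p J (u * y)).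
Proof.
move=> noeR pP JI; have [pI _ _] := pP.
have [socle|nsocle] := pselect (exists2 y, ~ saturation p J y &
  forall u, p u -> saturation p J (u * y)); [by right | left].
have [y Jy|x px Jx] := regular_or_socle_saturated noeR pI (saturation_ideal pP JI).
  apply: contrapT => nu; apply: nsocle; exists y => // u pu.
  by apply: contrapT => Juy; apply: nu; exists u.
by exists x => // u Jux; apply/Jx/sub_saturation.
Qed.

End IdealTheory.

(** * Projective modules *)

Section ProjectiveModules.
Variable R : comNzRingType.
Implicit Types (J K p : R -> Prop) (M N P : lmodType R).

Section Evaluation.
Import monalg.
Variable P : lmodType R.

(** [{malg R[P]}] serves as the free module on the set [P]; this is its canonical map onto [P]. *)
Definition malg_eval (g : {malg R[P]}) : P := \sum_(k <- msupp g) g@_k *: k.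

Lemma malg_evalEw (d : {fset P}) g : (msupp g `<=` d)%fset ->
  malg_eval g = \sum_(k <- d) g@_k *: k.
Proof.
move=> le; rewrite /malg_eval (big_fset_incl _ le) //= => k _ /mcoeff_outdom->.
by rewrite scale0r.
Qed.

Lemma malg_eval_linear : linear malg_eval.
Proof.
move=> a g h; pose d := (msupp g `|` msupp h `|` msupp (a *: g + h))%fset.
rewrite !(@malg_evalEw d); try by apply/fsubsetP => k; rewrite !inE => ->; rewrite ?orbT.
rewrite scaler_sumr -big_split; apply: eq_bigr => k _ /=.
by rewrite mcoeffD mcoeffZ scalerDl scalerA.
Qed.

HB.instance Definition _ :=
  GRing.isLinear.Build R {malg R[P]} P *:%R malg_eval malg_eval_linear.

Definition malg_coord (k : P) (g : {malg R[P]}) : R^o := g@_k.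

Lemma malg_coord_linear k : linear (malg_coord k).
Proof. by move=> a g h; rewrite /malg_coord mcoeffD mcoeffZ. Qed.

HB.instance Definition _ (k : P) :=
  GRing.isLinear.Build R {malg R[P]} R^o *:%R (malg_coord k) (malg_coord_linear k).

(** The coordinates come from a section of the free module on [P], and [bs] collects the supports of
    the images of [S]. *)
Lemma projective_dual_basis : projective_module P ->
  exists phi : P -> {linear P -> R^o}, forall S : seq P, exists bs : seq P,
  forall z, z \in S -> z = \sum_(b <- bs) phi b z *: b.
Proof.
case/(_ {malg R[P]} P malg_eval idfun) => [y|h hK].
  exists (mkmalgU y 1); apply: etrans (@malg_evalEw [fset y]%fset _ msuppU_le) _.
  by rewrite big_seq_fset1 mcoeffUU scale1r.
exists (fun b => malg_coord b \o h) => S.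
exists (\bigcup_(z <- S) msupp (h z))%fset => z Sz.
rewrite -[LHS](hK z) /=; apply: malg_evalEw.
by apply: (bigfcup_sup (j := z)).
Qed.

End Evaluation.

Section Combination.
Variables (P Q : lmodType R) (phi : P -> {linear P -> R^o}) (bs : seq P) (t : P -> Q).

(** Weighting by coordinates spreads an assignment on a finite list to a linear map on [P];
    homotopies are built this way. *)
Definition combination (z : P) : Q := \sum_(b <- bs) phi b z *: t b.

Lemma combination_linear : linear combination.
Proof.
move=> a y z; rewrite /combination scaler_sumr -big_split; apply: eq_bigr => b _.
by rewrite linearP scalerDl scalerA.
Qed.

HB.instance Definition _ :=
  GRing.isLinear.Build R P Q *:%R combination combination_linear.

Definition combination_map : {linear P -> Q} := combination.

End Combination.

(** * The submodule [K M] of a module [M] *)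

Definition ideal_smul K M (x : M) : Prop :=
  exists2 u : seq (R * M), forall a, a \in u -> K a.1 &
  x = \sum_(a <- u) a.1 *: a.2.

Lemma ideal_smul0 K M : ideal_smul K (0 : M).
Proof. by exists [::]; rewrite ?big_nil. Qed.

Lemma ideal_smulD K M (x y : M) : ideal_smul K x -> ideal_smul K y -> ideal_smul K (x + y).
Proof.
move=> [u uK ->] [v vK ->]; exists (u ++ v); last by rewrite big_cat.
by move=> a; rewrite mem_cat => /orP[/uK|/vK].
Qed.

Lemma ideal_smul_scale K M a (x : M) : K a -> ideal_smul K (a *: x).
Proof. by move=> Ka; exists [:: (a, x)]; rewrite ?big_seq1 // => b; rewrite inE => /eqP->. Qed.

Lemma ideal_smul_ind K M (F : M -> Prop) :
  F 0 -> (forall x y, F x -> F y -> F (x + y)) ->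
  (forall a x, K a -> F (a *: x)) -> forall x, ideal_smul K x -> F x.
Proof.
move=> F0 FD FK _ [u uK ->]; rewrite big_seq; apply: big_ind => // a /uK Ka.
exact: FK.
Qed.

Lemma ideal_smul_sub J K M (x : M) : subideal J K -> ideal_smul J x -> ideal_smul K x.
Proof. by move=> JK [u uJ ->]; exists u => // a /uJ /JK. Qed.

Lemma ideal_smul_linear K M N (f : {linear M -> N}) x :
  ideal_smul K x -> ideal_smul K (f x).
Proof.
move: x; apply: ideal_smul_ind => [|x y Kx Ky|a x Ka].
- by rewrite linear0; apply: ideal_smul0.
- by rewrite linearD; apply: ideal_smulD.
- by rewrite linearZ; apply: ideal_smul_scale.
Qed.

Lemma ideal_smulZ K M a (x : M) : is_ideal K -> ideal_smul K x -> ideal_smul K (a *: x).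
Proof.
move=> [_ _ KM]; move: x; apply: ideal_smul_ind => [|x y Kx Ky|b x Kb].
- by rewrite scaler0; apply: ideal_smul0.
- by rewrite scalerDr; apply: ideal_smulD.
- by rewrite scalerA; apply/ideal_smul_scale/KM.
Qed.

Lemma ideal_smulN K M (x : M) : is_ideal K -> ideal_smul K x -> ideal_smul K (- x).
Proof. by move=> KI; rewrite -scaleN1r; apply: ideal_smulZ. Qed.

Lemma ideal_smulB K M (x y : M) :
  is_ideal K -> ideal_smul K x -> ideal_smul K y -> ideal_smul K (x - y).
Proof. by move=> KI Kx Ky; apply: ideal_smulD => //; apply: ideal_smulN. Qed.

Lemma ideal_smul_sum K M (I : Type) (r : seq I) (F : I -> M) :
  (forall i, ideal_smul K (F i)) -> ideal_smul K (\sum_(i <- r) F i).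
Proof.
by move=> FK; apply: big_ind => // [|x y]; [exact: ideal_smul0 | exact: ideal_smulD].
Qed.

Lemma ideal_smul_zero M (x : M) : ideal_smul (fun a => a = 0) x -> x = 0.
Proof.
by move: x; apply: ideal_smul_ind => // [x y -> ->|a x ->]; rewrite ?addr0 ?scale0r.
Qed.

Lemma ideal_smul_regular K (x : R^o) : is_ideal K -> ideal_smul K x -> K x.
Proof.
move=> [K0 KD KM]; move: x; apply: ideal_smul_ind => // a x Ka.
by rewrite /GRing.scale /= mulrC; apply: KM.
Qed.

Lemma ideal_smul_adjoin J y M (z : M) : is_ideal J -> ideal_smul (adjoin J y) z ->
  exists w, ideal_smul J (z - y *: w).
Proof.
move=> JI; move: z; apply: ideal_smul_ind => [|u v [w Ju] [w' Jv]|_ x [j [a [Jj ->]]]].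
- by exists 0; rewrite scaler0 subr0; apply: ideal_smul0.
- exists (w + w'); rewrite scalerDr opprD addrACA; exact: ideal_smulD.
- exists (a *: x); rewrite scalerA scalerDl mulrC addrK; exact: ideal_smul_scale.
Qed.

Lemma ideal_smul_adjoinP J y M (z w : M) : is_ideal J ->
  ideal_smul J (z - y *: w) -> ideal_smul (adjoin J y) z.
Proof.
move=> JI Jz; rewrite -[z](subrK (y *: w)); apply: ideal_smulD.
  by apply: ideal_smul_sub Jz; apply: sub_adjoin.
exact/ideal_smul_scale/adjoin_mem1.
Qed.

Lemma ideal_smul_saturation p J M (z : M) : is_prime p -> is_ideal J ->
  ideal_smul (saturation p J) z -> exists2 s, ~ p s & ideal_smul J (s *: z).
Proof.
move=> pP JI; have [_ p1 _] := pP.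
move: z; apply: ideal_smul_ind => [|u v [s ps Ju] [t pt Jv]|a x [s ps Jsa]].
- by exists 1 => //; rewrite scaler0; apply: ideal_smul0.
- exists (s * t); first exact: prime_mul_notin.
  rewrite scalerDr -{1}[s * t]mulrC -!scalerA.
  by apply: ideal_smulD; apply: ideal_smulZ.
- by exists s => //; rewrite scalerA; apply: ideal_smul_scale.
Qed.

(** Flatness of [P]: the coordinates of [y *: z] lie in [K], so those of [z] lie in [colon K y]. *)
Lemma ideal_smul_colon P K y (z : P) : projective_module P -> is_ideal K ->
  ideal_smul K (y *: z) -> ideal_smul (colon K y) z.
Proof.
move=> /projective_dual_basis[phi phiP] KI Kyz; have [bs bsP] := phiP [:: z].
rewrite (bsP z (mem_head _ _)); apply: ideal_smul_sum => b.
apply: ideal_smul_scale; rewrite /colon mulrC; apply: ideal_smul_regular => //.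
have -> : y * phi b z = phi b (y *: z) by rewrite linearZ.
exact: ideal_smul_linear.
Qed.

Lemma ideal_smul_colonP K y M (z : M) :
  ideal_smul (colon K y) z -> ideal_smul K (y *: z).
Proof.
move: z; apply: ideal_smul_ind => [|u v Ku Kv|a x Ka].
- by rewrite scaler0; apply: ideal_smul0.
- by rewrite scalerDr; apply: ideal_smulD.
- by rewrite scalerA; apply: ideal_smul_scale; rewrite mulrC.
Qed.

End ProjectiveModules.

(** * Localized Tor of a projective resolution *)

Section Homology.
Variables (R : comNzRingType) (p : R -> Prop).
Variables (P : nat -> lmodType R) (d : forall i, {linear P i.+1 -> P i}).
Hypothesis pP : is_prime p.
Hypothesis dd0 : forall i x, d i (d i.+1 x) = 0.
Hypothesis projP : forall i, projective_module (P i).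
Implicit Types (J K : R -> Prop) (i j : nat).

Lemma d_lin i : (forall x y, d i (x + y) = d i x + d i y) *
  (forall x, d i (- x) = - d i x) * (forall a x, d i (a *: x) = a *: d i x).
Proof. by split=> [|a x]; [split=> [x y|x]|]; rewrite ?linearD ?linearN ?linearZ. Qed.

(** Cycles and boundaries of [P / K P] are represented by elements of [P], which avoids quotient
    complexes. *)
Definition cycle K j : P j -> Prop :=
  if j is j'.+1 return P j -> Prop then fun z => ideal_smul K (d j' z)
  else fun=> True.

Definition boundary K j (z : P j) : Prop := exists u, ideal_smul K (z - d j u).

Definition local_boundary K j (z : P j) : Prop :=
  exists2 s, ~ p s & boundary K (s *: z).

(* The vanishing of [Tor_j(E, R / K)] localized at [p], where [P] resolves [E]. *)
Definition tor_vanishes j K : Prop := forall z : P j, cycle K z -> local_boundary K z.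

Lemma cycleD K j (y z : P j) : cycle K y -> cycle K z -> cycle K (y + z).
Proof. by case: j y z => //= j y z Ky Kz; rewrite linearD; apply: ideal_smulD. Qed.

Lemma cycleZ K j a (z : P j) : is_ideal K -> cycle K z -> cycle K (a *: z).
Proof. by case: j z => //= j z KI Kz; rewrite linearZ; apply: ideal_smulZ. Qed.

Lemma cycleB K j (y z : P j) : is_ideal K -> cycle K y -> cycle K z -> cycle K (y - z).
Proof. by move=> KI Ky Kz; apply: cycleD => //; rewrite -scaleN1r; apply: cycleZ. Qed.

Lemma cycle_sub J K j (z : P j) : subideal J K -> cycle J z -> cycle K z.
Proof. by case: j z => //= j z JK; apply: ideal_smul_sub. Qed.

Lemma cycle_smul K j (z : P j) : ideal_smul K z -> cycle K z.
Proof. by case: j z => //= j z; apply: ideal_smul_linear. Qed.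

Lemma cycle_d K j (u : P j.+1) : cycle K (d j u).
Proof. by case: j u => //= j u; rewrite dd0; apply: ideal_smul0. Qed.

Lemma cycle_colon K y j (z : P j) : is_ideal K -> cycle K (y *: z) -> cycle (colon K y) z.
Proof. by case: j z => //= j z KI; rewrite linearZ; apply: ideal_smul_colon. Qed.

Lemma cycle_colonP K y j (z : P j) : cycle (colon K y) z -> cycle K (y *: z).
Proof. by case: j z => //= j z; rewrite linearZ; apply: ideal_smul_colonP. Qed.

Lemma cycle_saturation K j (z : P j) : is_ideal K -> cycle (saturation p K) z ->
  exists2 s, ~ p s & cycle K (s *: z).
Proof.
case: j z => [|j] z KI /=; first by exists 1 => //; case: pP.
by case/(ideal_smul_saturation pP KI) => s ps Ks; exists s => //; rewrite linearZ.
Qed.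

Lemma boundaryZ K j a (z : P j) : is_ideal K -> boundary K z -> boundary K (a *: z).
Proof.
move=> KI [u Kz]; exists (a *: u); rewrite linearZ -scalerBr; exact: ideal_smulZ.
Qed.

Lemma boundary_sub J K j (z : P j) : subideal J K -> boundary J z -> boundary K z.
Proof. by move=> JK [u Jz]; exists u; apply: ideal_smul_sub Jz. Qed.

Lemma boundary_local K j (z : P j) : boundary K z -> local_boundary K z.
Proof. by exists 1; [case: pP | rewrite scale1r]. Qed.

Lemma local_boundary_sub J K j (z : P j) :
  subideal J K -> local_boundary J z -> local_boundary K z.
Proof. by move=> JK [s ps Jz]; exists s => //; apply: boundary_sub Jz. Qed.

Lemma local_boundaryD K j (y z : P j) : is_ideal K ->
  local_boundary K y -> local_boundary K z -> local_boundary K (y + z).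
Proof.
move=> KI [s ps Ky] [t pt Kz]; exists (s * t); first exact: prime_mul_notin.
rewrite scalerDr -{1}[s * t]mulrC -!scalerA.
have [u Ku] := boundaryZ t KI Ky; have [v Kv] := boundaryZ s KI Kz.
by exists (u + v); rewrite linearD opprD addrACA; apply: ideal_smulD.
Qed.

Lemma local_boundaryZ K j a (z : P j) : is_ideal K ->
  local_boundary K z -> local_boundary K (a *: z).
Proof.
move=> KI [s ps Kz]; exists s => //; rewrite scalerA mulrC -scalerA.
exact: boundaryZ.
Qed.

Lemma local_boundary_cancel K j s (z : P j) :
  ~ p s -> local_boundary K (s *: z) -> local_boundary K z.
Proof.
move=> ps [t pt Kz]; exists (t * s); first exact: prime_mul_notin.
by rewrite -scalerA.
Qed.

Lemma local_boundary_smul K j (z : P j) : ideal_smul K z -> local_boundary K z.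
Proof. by move=> Kz; apply: boundary_local; exists 0; rewrite linear0 subr0. Qed.

Lemma tor_vanishes_saturation j J :
  is_ideal J -> tor_vanishes j J -> tor_vanishes j (saturation p J).
Proof.
move=> JI TJ z /(cycle_saturation JI)[s ps /TJ Jz].
apply: (local_boundary_cancel ps); apply: local_boundary_sub Jz.
exact: sub_saturation.
Qed.

(* The next two lemmas use [0 -> R / (K : y) -> R / K -> R / (K + y) -> 0]. *)
Lemma tor_vanishes_extension j K y : is_ideal K ->
  tor_vanishes j (colon K y) -> tor_vanishes j (adjoin K y) -> tor_vanishes j K.
Proof.
move=> KI Tc Ta z Kz.
have [s ps [u Ku]] := Ta z (cycle_sub (@sub_adjoin _ K y) Kz).
have [w Kw] := ideal_smul_adjoin KI Ku.
have [|t pt [u' /ideal_smul_colonP Ku']] := Tc w.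
  apply: cycle_colon => //.
  have -> : y *: w = s *: z - d j u - (s *: z - d j u - y *: w) by rewrite subKr.
  apply: cycleB => //; last exact: cycle_smul.
  by apply: cycleB; [|exact: cycleZ|exact: cycle_d].
exists (t * s); first exact: prime_mul_notin.
exists (t *: u + y *: u').
have -> : (t * s) *: z - d j (t *: u + y *: u') =
   t *: (s *: z - d j u - y *: w) + y *: (t *: w - d j u').
  by rewrite !d_lin; module R.
by apply: ideal_smulD => //; apply: ideal_smulZ.
Qed.

Lemma tor_colon_injective j K y (z : P j) : is_ideal K ->
  tor_vanishes j.+1 (adjoin K y) ->
  local_boundary K (y *: z) -> local_boundary (colon K y) z.
Proof.
move=> KI Ta [s ps [u Ku]].
have [|t pt [v /(ideal_smul_adjoin KI)[w Kw]]] := Ta u.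
  apply: (@ideal_smul_adjoinP _ _ _ _ _ (s *: z)) => //.
  by rewrite scalerA mulrC -scalerA -opprB; apply: ideal_smulN.
exists (t * s); first exact: prime_mul_notin.
exists w; apply: ideal_smul_colon => //.
have -> : y *: ((t * s) *: z - d j w) =
    t *: (s *: (y *: z) - d j u) + d j (t *: u - d j.+1 v - y *: w).
  by rewrite !d_lin dd0; module R.
by apply: ideal_smulD; [apply: ideal_smulZ | apply: ideal_smul_linear].
Qed.

Lemma regular_cycle J x j (z : P j) : is_ideal J -> regular_modulo p J x ->
  cycle J (x *: z) -> exists2 s, ~ p s & cycle J (s *: z).
Proof.
move=> JI Jx /(cycle_colon JI) Jz; apply: cycle_saturation => //.
exact: cycle_sub Jz.
Qed.

(** Homology in degree -1 counts as zero, so degree 0 shares the statements below. *)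
Definition tor_vanishes_below j J : Prop := if j is j'.+1 then tor_vanishes j' J else True.

(** Writing [d z] as [x *: w] modulo [J] computes the connecting map of multiplication by [x] on
    [R / J]; when the class of [w] vanishes, [z] lifts. *)
Lemma lift_cycle J x j (z : P j) : is_ideal J -> regular_modulo p J x ->
  tor_vanishes_below j J -> cycle (adjoin J x) z ->
  exists s u, ~ p s /\ cycle J (s *: z - x *: u).
Proof.
case: j z => [|j] z JI Jx TJ /=; first by exists 1, 0; case: pP.
case/(ideal_smul_adjoin JI) => w Jw.
have [|s ps /TJ[t pt [u Ju]]] := @regular_cycle J x j w JI Jx.
  have -> : x *: w = d j z - (d j z - x *: w) by rewrite subKr.
  by apply: cycleB => //; [exact: cycle_d | exact: cycle_smul].
exists (t * s), u; split; first exact: prime_mul_notin.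
have -> : d j ((t * s) *: z - x *: u) =
    (t * s) *: (d j z - x *: w) + x *: (t *: (s *: w) - d j u).
  by rewrite !d_lin; module R.
by apply: ideal_smulD; apply: ideal_smulZ.
Qed.

Lemma tor_vanishes_regular J x j : is_ideal J -> regular_modulo p J x ->
  tor_vanishes j J -> tor_vanishes_below j J -> tor_vanishes j (adjoin J x).
Proof.
move=> JI Jx TJ TJ' z /(lift_cycle JI Jx TJ')[s [u [ps /TJ Jz]]].
have JxI := adjoin_ideal x JI.
apply: (local_boundary_cancel ps); rewrite -[s *: z](subrK (x *: u)).
apply: local_boundaryD => //.
  by apply: local_boundary_sub Jz; apply: sub_adjoin.
by apply: local_boundary_smul; apply: ideal_smul_scale; apply: adjoin_mem1.
Qed.


(* Baer's criterion for the [R / J]-module [H_j(P / J P)], localized at [p]. *)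
Definition baer j J : Prop := forall n (a : 'I_n -> R) (z : 'I_n -> P j),
  (forall k, cycle J (z k)) ->
  (forall c : 'I_n -> R, J (\sum_k c k * a k) -> local_boundary J (\sum_k c k *: z k)) ->
  exists s w, [/\ ~ p s, cycle J w & forall k, local_boundary J (s *: z k - a k *: w)].

(** Baer's criterion for the single element [x] makes every cycle modulo [J] a multiple of [x] up to
    boundaries, and cycles modulo [J + (x)] lift to such cycles. *)
Lemma baer_regular j J x : is_ideal J -> regular_modulo p J x ->
  baer j J -> tor_vanishes_below j J -> tor_vanishes j (adjoin J x).
Proof.
move=> JI Jx BJ TJ z /(lift_cycle JI Jx TJ)[s [u [ps Jz]]].
have JxI := adjoin_ideal x JI.
have [//|c|t [w [pt _ /(_ ord0) Jw]]] := BJ 1%N (fun=> x) (fun=> s *: z - x *: u).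
  rewrite !big_ord1 => /Jx[t pt Jtc]; exists t => //; exists 0.
  by rewrite linear0 subr0 scalerA; apply: ideal_smul_scale.
apply: (local_boundary_cancel (prime_mul_notin pP pt ps)).
have xK v : local_boundary (adjoin J x) (x *: v : P j).
  by apply/local_boundary_smul/ideal_smul_scale/adjoin_mem1.
have -> : (t * s) *: z = t *: (s *: z - x *: u) - x *: w + x *: (t *: u + w).
  by module R.
apply: local_boundaryD => //.
by apply: local_boundary_sub Jw; apply: sub_adjoin.
Qed.

(** The connecting map identifies degree [j.+1] modulo [J + (x)] with the elements of degree [j]
    modulo [J] killed by [x]; in an injective module over [R / J] these form an injective module
    over [R / (J + (x))]. *)
Lemma baer_adjoin j J x : is_ideal J -> regular_modulo p J x ->
  baer j J -> tor_vanishes j.+1 J -> baer j.+1 (adjoin J x).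
Proof.
move=> JI Jx BJ TJ n a z Jz zP; have JxI := adjoin_ideal x JI.
have [_ p1 _] := pP.
have /choice[w Jw] : forall k, exists w, ideal_smul J (d j (z k) - x *: w).
  by move=> k; apply: ideal_smul_adjoin => //; apply: Jz.
have [||k _|s ps Jsw] := @common_multiple R (fun s => ~ p s) 'I_n (enum 'I_n)
    (fun k s => cycle J (s *: w k)) p1.
- by move=> s t; apply: prime_mul_notin.
- by move=> k s t Js; rewrite -scalerA; apply: cycleZ.
- apply: (regular_cycle JI Jx).
  have -> : x *: w k = d j (z k) - (d j (z k) - x *: w k) by rewrite subKr.
  by apply: cycleB => //; [exact: cycle_d | exact: cycle_smul].
(* The extra index 0 carries the equation [x *: v = 0], so that the solution is killed by [x]. *)
pose a' (k : 'I_n.+1) := if unlift ord0 k is Some k' then a k' else x.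
pose w' (k : 'I_n.+1) := if unlift ord0 k is Some k' then s *: w k' else 0.
have [k|c|t [v [pt Jv vP]]] := BJ n.+1 a' w'.
- rewrite /w'; case: unliftP => [k' _|_]; first by apply: Jsw; rewrite mem_enum.
  by apply: cycle_smul; apply: ideal_smul0.
- rewrite !big_ord_recl /a' /w' unlift_none scaler0 add0r.
  under eq_bigr do rewrite liftK; under [X in local_boundary _ X]eq_bigr do rewrite liftK.
  set c' := fun k => c (lift ord0 k) => Jc.
  have /zP[t pt [u /(ideal_smul_adjoin JI)[y Jy]]] : adjoin J x (\sum_k c' k * a k).
    exists (c ord0 * x + \sum_k c' k * a k), (- c ord0); split=> //; ring.
  have dy : ideal_smul J (x *: (t *: (\sum_k c' k *: w k) - d j y)).
    have -> : x *: (t *: (\sum_k c' k *: w k) - d j y) =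
        d j (t *: (\sum_k c' k *: z k) - d j.+1 u - x *: y) -
        t *: (\sum_k c' k *: (d j (z k) - x *: w k)).
      have -> : \sum_k c' k *: (d j (z k) - x *: w k) =
          d j (\sum_k c' k *: z k) - x *: \sum_k c' k *: w k.
        rewrite (linear_sum (d j)) scaler_sumr -sumrB; apply: eq_bigr => k _.
        by rewrite d_lin; module R.
      by rewrite !d_lin dd0; module R.
    apply: ideal_smulB => //; first exact: ideal_smul_linear.
    by apply: ideal_smulZ => //; apply: ideal_smul_sum => k; apply: ideal_smulZ.
  (* Flatness and the regularity of [x] cancel the factor [x]. *)
  have /(ideal_smul_saturation pP JI)[r pr Jr] : ideal_smul (saturation p J)
      (t *: (\sum_k c' k *: w k) - d j y).
    exact: (ideal_smul_sub Jx (ideal_smul_colon (@projP j) JI dy)).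
  have Jb : local_boundary J (\sum_k c' k *: w k).
    exists (r * t); first exact: prime_mul_notin.
    by exists (r *: y); rewrite d_lin -scalerA -scalerBr.
  under eq_bigr do rewrite scalerA mulrC -scalerA.
  by rewrite -scaler_sumr; apply: local_boundaryZ.
have [r pr [u Ju]] : local_boundary J (x *: v).
  have := vP ord0; rewrite /a' /w' unlift_none scaler0 sub0r => Jv'.
  by rewrite -[_ *: _]opprK -scaleN1r; apply: local_boundaryZ.
have JxK : subideal J (adjoin J x) := @sub_adjoin _ J x.
(* As [d u] is [x *: (r *: v)] modulo [J], the connecting map sends [u] to the class of [r *: v]. *)
exists (r * t * s), u; split; first by do !apply: prime_mul_notin.
  apply: (@ideal_smul_adjoinP _ _ _ _ _ (r *: v)) => //.
  by rewrite scalerA mulrC -scalerA -opprB; apply: ideal_smulN.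
move=> k; have := vP (lift ord0 k); rewrite /a' /w' liftK => -[q pq [y Jy]].
set zk := (r * t * s) *: z k - a k *: u.
have Jc : cycle J (q *: zk - x *: (r *: y)).
  have Jdy := ideal_smulZ (r * x) JI Jy.
  have := ideal_smulD (ideal_smulZ (q * r * t * s) JI (Jw k))
    (ideal_smulD Jdy (ideal_smulZ (q * a k) JI Ju)).
  congr (ideal_smul J _); rewrite /zk !d_lin; module R.
apply: (local_boundary_cancel pq); rewrite -[q *: zk](subrK (x *: (r *: y))).
apply: local_boundaryD => //.
  by apply: local_boundary_sub (TJ _ Jc).
exact/local_boundary_smul/ideal_smul_scale/adjoin_mem1.
Qed.


(** * Contracting homotopies on finite sets, up to a multiplicative set *)

Section Homotopy.
Variables (S : R -> Prop) (J : R -> Prop).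
Hypotheses (S1 : S 1) (SM : forall s t, S s -> S t -> S (s * t)) (JI : is_ideal J).

(** The qualification refers to factors from [S]; the condition concerns degree [i] alone. *)
Definition exact_up_to i : Prop :=
  forall z : P i, cycle J z -> exists2 t, S t & boundary J (t *: z).

(* [h] and [g] are a contracting homotopy on the finite set [L], up to the
   factor [t]; the condition on [g] holds for maps that factor through [d]. *)
Definition homotopy i : Prop := forall L : seq (P i),
  exists t (h : {linear P i -> P i.+1}) (g : {linear P i -> P i}),
  [/\ S t, forall K z, is_ideal K -> cycle K z -> ideal_smul K (g z)
         & forall z, z \in L -> ideal_smul J (t *: z - d i (h z) - g z)].

(** The homotopy is chosen on the finitely many dual basis elements that expand [L], then spread by
    [combination_map]. *)
Lemma homotopy_extend i : exact_up_to i ->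
  (forall L : seq (P i), exists t (g : {linear P i -> P i}),
    [/\ S t, forall K z, is_ideal K -> cycle K z -> ideal_smul K (g z)
           & forall z, z \in L -> cycle J (t *: z - g z)]) ->
  homotopy i.
Proof.
move=> Hi Hg L; have [phi phiP] := projective_dual_basis (@projP i).
have [bs bsP] := phiP L; have [t [g [St gK gbs]]] := Hg bs.
have [||r Sr Jr] := @common_multiple R S _ bs
    (fun b r => boundary J (r *: (t *: b - g b))) S1 SM.
- by move=> b q r; rewrite -scalerA; apply: boundaryZ.
- by move=> b /gbs /Hi.
have /choice[u Ju] : forall b, exists u : P i.+1,
    b \in bs -> ideal_smul J (r *: (t *: b - g b) - d i u).
  move=> b; have [bsb|nbsb] := boolP (b \in bs); last by exists 0.
  by have [u Ju] := Jr b bsb; exists u.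
pose rg : {linear P i -> P i} := r \*: g.
exists (r * t), (combination_map phi bs u), rg; split.
- exact: SM.
- by move=> K z KI Kz; apply: ideal_smulZ => //; apply: gK.
move=> z /bsP zE; rewrite /= /combination linear_sum {1}zE scaler_sumr.
have -> : g z = \sum_(b <- bs) phi b z *: g b.
  by rewrite {1}zE linear_sum; apply: eq_bigr => b _; rewrite linearZ.
rewrite scaler_sumr -!sumrB big_seq; apply: big_ind => [|x y|b bsb].
- exact: ideal_smul0.
- exact: ideal_smulD.
have := ideal_smulZ (phi b z) JI (Ju b bsb); congr (ideal_smul J _).
by rewrite d_lin; module R.
Qed.

Lemma homotopy_exists i : (forall j, (j <= i)%N -> exact_up_to j) -> homotopy i.
Proof.
elim: i => [|i IH] Hi; apply: homotopy_extend; try exact: Hi.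
  move=> L; exists 1, (\0 : {linear P 0%N -> P 0%N}); split=> //.
  by move=> K z _ _; apply: ideal_smul0.
move=> L; have [|t [h [g [St gK hgK]]]] := IH _ (map (d i) L).
  by move=> j lej; apply/Hi/leqW.
(* Here [g] is [h] after [d], so it sends cycles modulo [K] into [K P]. *)
exists t, (h \o d i : {linear P i.+1 -> P i.+1}); split=> //.
  by move=> K z _ Kz; exact: (ideal_smul_linear h Kz).
move=> z Lz; have := hgK (d i z) (map_f _ Lz).
have -> : g (d i z) = 0.
  by apply: ideal_smul_zero; apply: gK; [exact: zero_ideal | exact: cycle_d].
by rewrite subr0 /= !d_lin.
Qed.

(** [g] sends a cycle modulo [K] into [K P], so a homotopy built modulo [J] serves for every larger
    [K]. *)
Lemma homotopy_boundary K i z : (forall j, (j <= i)%N -> exact_up_to j) ->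
  is_ideal K -> subideal J K -> cycle K z -> exists2 t, S t & boundary K (t *: z : P i).
Proof.
move=> /homotopy_exists /(_ [:: z])[t [h [g [St gK hgK]]]] KI JK Kz.
exists t => //; exists (h z); rewrite -[_ - _](subrK (g z)).
apply: ideal_smulD; last exact: gK.
by apply: (ideal_smul_sub JK); apply: hgK; rewrite mem_head.
Qed.

(** With [d z] written as a sum of [a.1 *: a.2], subtracting the [a.1 *: h a.2] from [t *: z] makes
    its image under [d] vanish modulo [J]. *)
Lemma homotopy_lift K i (z : P i) : (forall j, (j < i)%N -> exact_up_to j) ->
  is_ideal K -> cycle K z ->
  exists t w, [/\ S t, cycle J w & ideal_smul K (t *: z - w)].
Proof.
case: i z => [|i] z Hi KI Kz.
  by exists 1, z; split=> //; rewrite scale1r subrr; apply: ideal_smul0.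
case: (Kz) => u uK dzE.
have [t [h [g [St gK hgK]]]] := homotopy_exists Hi (map snd u).
exists t, (t *: z - \sum_(a <- u) a.1 *: h a.2); split=> //; last first.
  rewrite subKr big_seq; apply: big_ind => [|x y|a ua].
  - exact: ideal_smul0.
  - exact: ideal_smulD.
  - by apply: ideal_smul_scale; apply: uK.
have gdz : g (d i z) = 0.
  by apply: ideal_smul_zero; apply: gK; [exact: zero_ideal | exact: cycle_d].
rewrite /= !d_lin -[X in ideal_smul _ X]subr0 -gdz dzE scaler_sumr.
rewrite (linear_sum (d i)) (linear_sum g) -sumrN -big_split -sumrB /= big_seq.
apply: big_ind => [|x y|[a w] ua].
- exact: ideal_smul0.
- exact: ideal_smulD.
have := ideal_smulZ a JI (hgK w (map_f snd ua)); congr (ideal_smul J _).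
by rewrite /= ?d_lin (linearZ_LR g); module R.
Qed.

End Homotopy.


Fixpoint local_regular_sequence (xs : seq R) : Prop :=
  if xs is x :: xs' then
    [/\ local_regular_sequence xs', p x & regular_modulo p (ideal_span xs') x]
  else True.

(** Each regular element raises by one the only degree where homology can survive: divisibility
    clears the old degree, the long exact sequence the others. *)
Lemma tor_regular_sequence xs :
  baer 0 (fun u : R => u = 0) -> (forall j, tor_vanishes j.+1 (fun u : R => u = 0)) ->
  local_regular_sequence xs ->
  baer (size xs) (ideal_span xs) /\ forall j, j != size xs -> tor_vanishes j (ideal_span xs).
Proof.
move=> B0 T0; elim: xs => [|x xs IH] /=; first by split=> // -[].
case=> /IH[Bx Tx] px Jx; have JI := ideal_span_is_ideal xs; split.
  by apply: baer_adjoin => //; apply: Tx; rewrite eqn_leq ltnn.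
have below j : (j <= size xs)%N \/ (j > (size xs).+1)%N ->
    tor_vanishes_below j (ideal_span xs).
  case: j => //= j lej; apply: Tx; case: lej => [|] lej.
    by rewrite neq_ltn lej.
  by rewrite neq_ltn (lej : size xs < j)%N orbT.
move=> j jx; have [->|njx] := eqVneq j (size xs).
  by apply: baer_regular => //; apply: below; left.
apply: tor_vanishes_regular => //; first exact: Tx.
apply: below; case: (ltngtP j (size xs).+1) jx => // ltj _; [left|by right].
by rewrite -ltnS.
Qed.

(** * The top nonvanishing degree of localized Tor *)

Section TopTor.
Variable n : nat.
Hypothesis noeR : noetherian R.
Hypothesis torsion : forall y, p y -> forall j K (z : P j),
  is_ideal K -> cycle K z -> exists k, local_boundary K (y ^+ k *: z).
Hypothesis top : forall K, is_ideal K -> tor_vanishes n.+1 K.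

Lemma tor_vanishes_unit K s : K s -> ~ p s -> tor_vanishes n K.
Proof.
move=> Ks ps z _; apply: (local_boundary_cancel ps).
by apply/local_boundary_smul/ideal_smul_scale.
Qed.

(** By left exactness in the top degree [y] acts injectively on the homology modulo [K], while each
    class is killed by a power of [y]. *)
Lemma tor_vanishes_torsion_free K y : is_ideal K -> p y -> subideal (colon K y) K ->
  tor_vanishes n K.
Proof.
move=> KI py Ky z Kz; have [k] := torsion py KI Kz.
elim: k => [|k IH]; first by rewrite scale1r.
rewrite exprS -scalerA => /(tor_colon_injective KI (top (adjoin_ideal y KI))).
by move=> /(local_boundary_sub Ky) /IH.
Qed.

Lemma tor_residue_field : (exists2 K, is_ideal K & ~ tor_vanishes n K) -> ~ tor_vanishes n p.
Proof.
case=> K0 K0I TK0.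
pose F K := is_ideal K /\ ~ tor_vanishes n K.
have [| |K [[KI TK] _ Kmax]] := @noetherian_maximal R F K0 noeR.
- by move=> K [].
- by split.
have Kp : subideal K p.
  by move=> s Ks; apply: contrapT => ps; apply/TK/(tor_vanishes_unit Ks ps).
suff pK : subideal p K.
  by have -> : p = K by apply/funext => u; apply/propext; split=> [/pK|/Kp].
move=> y py; apply: contrapT => Ky; apply: TK.
have Ta : tor_vanishes n (adjoin K y).
  apply: contrapT => nTa; apply: Ky; apply: (Kmax (adjoin K y)).
  - by split=> //; apply: adjoin_ideal.
  - exact: sub_adjoin.
  - exact: adjoin_mem1.
(* If the colon term survives, maximality gives [colon K y = K], and torsion kills the homology
   modulo [K]. *)
have [Tc|nTc] := pselect (tor_vanishes n (colon K y)).
  exact: tor_vanishes_extension Tc Ta.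
apply: (tor_vanishes_torsion_free KI py); apply: Kmax; last exact: sub_colon.
by split=> //; apply: colon_ideal.
Qed.

(** Left exactness in the top degree, applied to the embedding of [R / p] into [R / J] at [p] given
    by [y]. *)
Lemma tor_socle J y : is_ideal J -> ~ tor_vanishes n p ->
  ~ saturation p J y -> (forall u, p u -> saturation p J (u * y)) -> ~ tor_vanishes n J.
Proof.
move=> JI Tp Jy py /(tor_vanishes_saturation JI) TJ; apply: Tp => z pz.
have sJI := saturation_ideal pP JI.
have pE : colon (saturation p J) y = p.
  apply/funext => u; apply/propext; split=> [Ju|/py //].
  apply: contrapT => pu; apply: Jy.
  exact: (@saturation_saturated _ _ J pP _ _ pu Ju).
rewrite -pE; apply: tor_colon_injective => //.
  exact/top/adjoin_ideal.
by apply: TJ; apply: cycle_colonP; rewrite pE.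
Qed.

Lemma tor_top_nilpotent J : is_ideal J -> ~ tor_vanishes n p ->
  (forall j, (j < n)%N -> tor_vanishes j J) ->
  forall y, p y -> exists k, saturation p J (y ^+ k).
Proof.
move=> JI Tp TJ y py; apply: contrapT => ny; apply: Tp.
have sJI := saturation_ideal pP JI.
(* The ideals [J : y ^ k], saturated at [p], become stationary at some [L], and [y] is regular on
   [R / L]. *)
pose F K := exists k, K = colon (saturation p J) (y ^+ k).
have [| |_ [[k ->] _ Lmax]] :=
  @noetherian_maximal R F (colon (saturation p J) (y ^+ 0)) noeR.
- by move=> _ [k ->]; apply: colon_ideal.
- by exists 0%N.
set L := colon _ _ in Lmax; have LI : is_ideal L := colon_ideal (y ^+ k) sJI.
have JL : subideal J L.
  by move=> u Ju; apply: (sub_colon _ sJI); apply: (sub_saturation pP).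
have Lp : subideal L p.
  apply: (saturated_proper LI).
    by apply: colon_saturated; apply: (saturation_saturated pP).
  by move=> L1; apply: ny; exists k; rewrite -[y ^+ k]mul1r.
have TL : tor_vanishes n L.
  apply: (tor_vanishes_torsion_free LI py) => u Lu.
  apply: (Lmax (colon (saturation p J) (y ^+ k.+1))); first by exists k.+1.
    by move=> v Lv; rewrite /colon exprS mulrCA; have [_ _] := sJI; apply.
  by rewrite /colon exprS mulrA.
have [pI p1 _] := pP; move=> z pz.
have pM s t : ~ p s -> ~ p t -> ~ p (s * t) by apply: prime_mul_notin.
have exJ j : (j < n)%N -> exact_up_to (fun s => ~ p s) J j.
  by move=> ltj w /(TJ j ltj)[s ps Js]; exists s.
(* The map onto the homology modulo [p] factors through that modulo [L], which vanishes. *)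
have [t [w [pt Jw pzw]]] := homotopy_lift p1 pM JI exJ pI pz.
apply: (local_boundary_cancel pt); rewrite -[t *: z](subrK w).
apply: local_boundaryD => //; first exact: local_boundary_smul.
apply: (local_boundary_sub Lp); apply: TL.
exact: cycle_sub Jw.
Qed.

End TopTor.

End Homology.

(** * Injective hulls of prime quotients *)

Section IdealModule.
Variables (R : comNzRingType) (I : R -> Prop) (II : is_ideal I).

(* [II] is mentioned so that the module structure below can be inferred. *)
Definition ideal_pred : {pred R^o} := let _ := II in fun x => `[< I x >].

Lemma ideal_pred_closed : submod_closed ideal_pred.
Proof.
have [I0 ID IM] := II; split; first exact/asboolP.
by move=> a x y /asboolP Ix /asboolP Iy; apply/asboolP/ID => //; apply: IM.
Qed.

HB.instance Definition _ := GRing.isSubmodClosed.Build R R^o ideal_pred ideal_pred_closed.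

Record ideal_module := IdealModule { ideal_val : R^o; _ : ideal_val \in ideal_pred }.
HB.instance Definition _ := [isSub for ideal_val].
HB.instance Definition _ := [Choice of ideal_module by <:].
HB.instance Definition _ := [SubChoice_isSubLmodule of ideal_module by <:].

End IdealModule.

Section Hull.
Variables (R : comNzRingType) (E : lmodType R).

(** * Baer's criterion for an injective module *)

Section Map.
Variables (n : nat) (a : 'I_n -> R) (z : 'I_n -> E).
Hypothesis az : forall c : 'I_n -> R, \sum_k c k * a k = 0 -> \sum_k c k *: z k = 0.

Definition combinations (x : R) : Prop := exists c : 'I_n -> R, x = \sum_k c k * a k.

Lemma combinations_ideal : is_ideal combinations.
Proof.
split; first by exists (fun=> 0); rewrite big1 // => i; rewrite mul0r.
- move=> _ _ [c ->] [e ->]; exists (fun i => c i + e i).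
  by rewrite -big_split; apply: eq_bigr => i _; rewrite mulrDl.
- move=> b _ [c ->]; exists (fun i => b * c i).
  by rewrite mulr_sumr; apply: eq_bigr => i _; rewrite mulrA.
Qed.

Lemma combinations_val (x : ideal_module combinations_ideal) : combinations (val x).
Proof. by apply/asboolP; case: x. Qed.

(** The coefficients are chosen, and [az] makes the value independent of the choice. *)
Definition combinations_map (x : ideal_module combinations_ideal) : E :=
  \sum_k projT1 (cid (combinations_val x)) k *: z k.

Lemma combinations_mapE x c : val x = \sum_k c k * a k ->
  combinations_map x = \sum_k c k *: z k.
Proof.
move=> xc; apply/eqP; rewrite -subr_eq0 -sumrB; apply/eqP.
under eq_bigr do rewrite -scalerBl.
apply: az; under eq_bigr do rewrite mulrBl.
by rewrite sumrB -xc; case: cid => e /= <-; rewrite subrr.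
Qed.

Lemma combinations_map_linear : linear combinations_map.
Proof.
move=> b x y; have [c xc] := combinations_val x; have [e ye] := combinations_val y.
rewrite (combinations_mapE xc) (combinations_mapE ye) scaler_sumr -big_split /=.
rewrite (@combinations_mapE _ (fun k => b * c k + e k)).
  by apply: eq_bigr => k _; rewrite scalerDl scalerA.
transitivity (b * val x + val y : R); first by [].
rewrite xc ye mulr_sumr -big_split.
by apply: eq_bigr => k _; rewrite mulrDl mulrA.
Qed.

HB.instance Definition _ :=
  GRing.isLinear.Build R (ideal_module combinations_ideal) E *:%R combinations_map
    combinations_map_linear.

(** The solution is the value at 1 of an extension to [R] of the map sending each [a k] to [z k]. *)
Lemma injective_baer : injective_module E -> exists w, forall k, a k *: w = z k.
Proof.
move=> /(_ (ideal_module combinations_ideal) R^o val combinations_map val_inj)[h hP].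
exists (h 1) => k; pose c j : R := (j == k)%:R.
have ak : a k = \sum_j c j * a j.
  by rewrite (bigD1 k) //= /c eqxx mul1r big1 ?addr0 // => j /negPf->; rewrite mul0r.
have akP : (a k : R^o) \in ideal_pred combinations_ideal by apply/asboolP; exists c.
rewrite -linearZ /= [_ *: 1]mulr1 (hP (IdealModule akP)).
apply: etrans (combinations_mapE (c := c) _) _ => //.
rewrite (bigD1 k) //= /c eqxx scale1r big1 ?addr0 //.
by move=> j /negPf->; rewrite scale0r.
Qed.

End Map.

(** * Torsion in the hull of [R / p] *)

Variable p : Spec R.

Lemma quotient_scale_eq0 (a : R) (x : quotient_module p) :
  a *: x = 0 -> a \in p \/ x = 0.
Proof.
move=> ax; have /orP[/eqP a0|/eqP] := @Quotient.rquot_IdomainAxiom R p _ _ ax; last by right.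
by left; rewrite -[a]subr0 Quotient.idealrBE; apply/eqP; rewrite a0 rmorph0.
Qed.

Lemma quotient_scale0 (a : R) (x : quotient_module p) : a \in p -> a *: x = 0.
Proof.
rewrite -[a in a \in p]subr0 Quotient.idealrBE => /eqP a0.
by rewrite /GRing.scale /= /QuotientModule.scale a0 rmorph0 mul0r.
Qed.

Variable inc : {linear (quotient_module p) -> E}.
Hypothesis noeR : noetherian R.
Hypothesis hullE : injective_envelope inc.

(** The elements killed by [s] form a submodule; were it nonzero it would meet [R / p], on which [s]
    acts injectively. *)
Lemma hull_torsion_free s (e : E) : s \notin p -> s *: e = 0 -> e = 0.
Proof.
move=> ps se; apply: contrapT => e0; have [inji essi _] := hullE.
have [||x] := essi [pred e | s *: e == 0].
- split; first by rewrite inE scaler0.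
  move=> a x y; rewrite !inE => /eqP sx /eqP sy.
  by rewrite scalerDr scalerA mulrC -scalerA sx sy scaler0 addr0.
- by exists e; [rewrite inE se | apply/eqP].
rewrite inE -linearZ => /eqP isx ix0.
have : s *: x = 0 by apply: inji; rewrite isx linear0.
by case/quotient_scale_eq0 => [/(negP ps)//|x0]; rewrite x0 linear0 eqxx in ix0.
Qed.

(** The annihilators of [y ^+ k *: e] become stationary. A multiple of the stationary term lying in
    [R / p] is killed by [y], hence already zero. *)
Lemma hull_torsion y (e : E) : y \in p -> exists k, y ^+ k *: e = 0.
Proof.
move=> py; apply: contrapT => ny; have [inji essi _] := hullE.
pose ann (x : E) (a : R) := a *: x = 0.
pose F K := exists k, K = ann (y ^+ k *: e).
have [| |_ [[k ->] _ kmax]] := @noetherian_maximal R F (ann (y ^+ 0 *: e)) noeR.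
- move=> _ [k ->]; split; first exact: scale0r.
  + by move=> a b ak bk; rewrite /ann scalerDl ak bk addr0.
  + by move=> a b bk; rewrite /ann -scalerA bk scaler0.
- by exists 0%N.
have [||x] := essi [pred v | `[< exists a, v = a *: (y ^+ k *: e) >]].
- split; first by rewrite inE; apply/asboolP; exists 0; rewrite scale0r.
  move=> c _ _ /asboolP[a ->] /asboolP[b ->]; apply/asboolP; exists (c * a + b).
  by rewrite scalerDl -scalerA.
- exists (y ^+ k *: e); first by rewrite inE; apply/asboolP; exists 1; rewrite scale1r.
  by apply/eqP => yke; apply: ny; exists k.
move=> /asboolP[a ixa] /eqP; apply; rewrite ixa.
have annS b : b *: (y ^+ k.+1 *: e) = y *: (b *: (y ^+ k *: e)).
  by rewrite exprS; module R.
apply: (kmax (ann (y ^+ k.+1 *: e))); first by exists k.+1.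
  by move=> b bk; rewrite /ann annS bk scaler0.
rewrite /ann annS -ixa -linearZ.
by rewrite quotient_scale0 ?linear0.
Qed.


(** * A finite projective resolution of the hull *)

Section FiniteResolution.
Variables (n : nat) (P : nat -> lmodType R) (d : forall j, {linear P j.+1 -> P j}).
Variable e : {linear P 0 -> E}.
Hypothesis resE : projective_resolution n d e.

Let q : R -> Prop := fun x => x \in p.

Lemma mem_prime_is_prime : is_prime q.
Proof.
split; last 2 first.
- by rewrite /q idealr1.
- by move=> x y; rewrite /q prime_idealrM => /orP.
by split=> [|x y px py|a x px]; rewrite /q ?idealr0 ?rpredD // prime_idealrM px orbT.
Qed.

Let qP := mem_prime_is_prime.

Lemma resolution_dd i x : d i (d i.+1 x) = 0.
Proof. by case: resE => _ _ _ _ dP; apply/dP; exists x. Qed.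

Lemma resolution_projective i : projective_module (P i).
Proof. by case: resE. Qed.

Let dd := resolution_dd.
Let projP := resolution_projective.

Lemma resolution_exact i (z : P i.+1) : d i z = 0 -> boundary d (fun a => a = 0) z.
Proof.
case: resE => _ _ _ _ dP /dP[u <-]; exists u.
by rewrite subrr; apply: ideal_smul0.
Qed.

Lemma resolution_boundary0 (z : P 0%N) : e z = 0 -> boundary d (fun a => a = 0) z.
Proof.
case: resE => _ _ _ eP _ /eP[u <-]; exists u.
by rewrite subrr; apply: ideal_smul0.
Qed.

Lemma resolution_local_boundary0 (z : P 0%N) :
  local_boundary q d (fun a => a = 0) z -> e z = 0.
Proof.
case: resE => _ _ _ eP _ [s /negP ps [u /ideal_smul_zero/eqP]].
rewrite subr_eq0 => /eqP sz; apply: (hull_torsion_free ps).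
by rewrite -linearZ; apply/eP; exists u.
Qed.

Lemma resolution_tor j : tor_vanishes q d j.+1 (fun a => a = 0).
Proof. by move=> z /ideal_smul_zero/resolution_exact; apply: boundary_local. Qed.

(** The cokernel of [d 0] is [E], so the criterion is that of the injective module [E]. *)
Lemma resolution_baer : baer q d 0 (fun a => a = 0).
Proof.
move=> k a z _ zP; have [_ _ injE] := hullE.
have [c ac|w wP] := @injective_baer k a (e \o z) _ injE.
  have /resolution_local_boundary0 := zP c ac.
  by rewrite linear_sum; under eq_bigr do rewrite linearZ.
have [v vw] : exists v, e v = w by case: resE.
exists 1, v; split=> //; first by case: qP.
move=> j; apply/(boundary_local qP)/resolution_boundary0.
by rewrite scale1r linearB linearZ /= vw wP subrr.
Qed.

(** The resolution is exact up to powers of [y], in degree 0 because [E] is torsion; a homotopy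
    carries this over to [P / K P]. *)
Lemma resolution_torsion y : q y -> forall j K (z : P j), is_ideal K -> cycle d K z ->
  exists k, local_boundary q d K (y ^+ k *: z).
Proof.
move=> py j K z KI Kz; pose S t := exists k, t = y ^+ k.
have S1 : S 1 by exists 0%N.
have SM s t : S s -> S t -> S (s * t).
  by move=> [k ->] [l ->]; exists (k + l)%N; rewrite exprD.
have exS i' : (i' <= j)%N -> exact_up_to d S (fun a => a = 0) i'.
  case: i' => [|i'] _ w; last first.
    by move=> /ideal_smul_zero/resolution_exact; exists 1; rewrite ?scale1r.
  move=> _; have [k yk] := hull_torsion (e w) py; exists (y ^+ k); first by exists k.
  by apply: resolution_boundary0; rewrite linearZ.
have K0 : subideal (fun a => a = 0) K by move=> _ ->; case: KI.
have [_ [k ->] Kb] := homotopy_boundary dd projP S1 SM (@zero_ideal R) exS KI K0 Kz.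
by exists k; apply: boundary_local.
Qed.

Lemma resolution_tor0 : ~ tor_vanishes q d 0 (fun a => a = 0).
Proof.
move=> T0; have [inji _ _] := hullE.
have [z ez] : exists z, e z = inc (1 : ResidueDomain.type p) by case: resE.
have /resolution_local_boundary0 := T0 z I.
rewrite ez => /eqP; rewrite -(linear0 inc) (inj_eq inji).
by rewrite oner_eq0.
Qed.

Lemma nilpotent_regular_sequence : exists2 xs, local_regular_sequence q xs &
  forall y, q y -> exists k, saturation q (ideal_span xs) (y ^+ k).
Proof.
pose T j := `[< exists2 K, is_ideal K & ~ tor_vanishes q d j K >].
have exT : exists j, T j by exists 0%N; apply/asboolP; exists (fun a => a = 0);
  [exact: zero_ideal | exact: resolution_tor0].
(* The resolution vanishes above [n], which bounds the degrees. *)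
have leT j : T j -> (j <= n)%N.
  move=> /asboolP[K _ TK]; rewrite leqNgt; apply/negP => ltnj; apply: TK => z _.
  case: resE => _ /(_ _ ltnj z) -> _ _ _; apply: local_boundary_smul => //.
  exact: ideal_smul0.
have [r /asboolP Tr rmax] := ex_maxnP exT leT.
have topT K : is_ideal K -> tor_vanishes q d r.+1 K.
  move=> KI; apply: contrapT => TK; have /rmax : T r.+1 by apply/asboolP; exists K.
  by rewrite ltnn.
have Tq := tor_residue_field qP dd projP noeR resolution_torsion topT Tr.
(* The sequence is chosen with maximal saturated ideal, not with maximal length. *)
pose F K := exists2 xs, local_regular_sequence q xs & K = saturation q (ideal_span xs).
have [| |_ [[xs xsP ->] _ xsmax]] :=
  @noetherian_maximal R F (saturation q (ideal_span [::])) noeR.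
- by move=> _ [xs _ ->]; apply/saturation_ideal/ideal_span_is_ideal.
- by exists [::].
exists xs => //; have JI := ideal_span_is_ideal xs.
have [[x qx Jx]|[y Jy qy]] := regular_or_socle noeR qP JI.
  (* A further regular [x] would already lie in the saturated ideal; then an element outside [p]
     would lie in the span of [xs], which is inside [p]. *)
  have [s qs Jsx] : saturation q (ideal_span xs) x.
    apply: (xsmax (saturation q (ideal_span (x :: xs)))).
    - by exists (x :: xs).
    - move=> u [s qs Ju]; exists s => //; exact: sub_adjoin.
    - by apply: sub_saturation => //; apply: adjoin_mem1.
  have [t qt Jts] := Jx s Jsx; case: (prime_mul_notin qP qt qs).
  have [qI _ _] := qP; apply: (span_over_sub _ _ _ Jts) => //.
    by move=> _ ->; case: qI.
  move=> {x qx Jx Jsx} x; elim: (xs) xsP => //= z zs IH [/IH zsP qz _].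
  by rewrite inE => /orP[/eqP->|].
have TJ := tor_socle qP dd projP topT JI Tq Jy qy.
have [_ Tx] := tor_regular_sequence qP dd projP resolution_baer resolution_tor xsP.
(* Homology modulo the span of [xs] is nonzero in degree [r], and [size xs] is the only degree where
   it can be. *)
have rE : r = size xs by apply/eqP/negP => /negP/Tx.
apply: (tor_top_nilpotent qP dd projP noeR resolution_torsion topT JI Tq).
by move=> j ltj; apply: Tx; rewrite -rE ltn_eqF.
Qed.

End FiniteResolution.

End Hull.

(** * Passage to the localization *)

Section PrimeChains.
Variable R : comNzRingType.
Implicit Types q : R -> Prop.

Section SpecOfPrime.
Variables (q : R -> Prop) (qP : is_prime q).

Definition prime_pred : {pred R} := let _ := qP in fun x => `[< q x >].

Lemma prime_pred_idealr : idealr_closed prime_pred.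
Proof.
have [[q0 qD qM] q1 _] := qP; split; first exact/asboolP.
  exact/asboolP.
by move=> a x y /asboolP qx /asboolP qy; apply/asboolP/qD => //; apply: qM.
Qed.

HB.instance Definition _ := isIdealr.Build R prime_pred prime_pred_idealr.

Lemma prime_pred_prime : prime_idealr_closed prime_pred.
Proof.
have [_ _ qM] := qP; move=> x y /asboolP/qM[qx|qy]; apply/orP; [left|right]; exact/asboolP.
Qed.

HB.instance Definition _ := isPrimeIdealrClosed.Build R prime_pred prime_pred_prime.

Definition spec_of_prime : Spec R := prime_pred.

Lemma mem_spec_of_prime x : x \in spec_of_prime <-> q x.
Proof. by split=> /asboolP. Qed.

End SpecOfPrime.

Lemma has_prime_chain_of_chain l (a c : R -> Prop) :
  is_prime a -> is_prime c -> chain l a c -> has_prime_chain R l.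
Proof.
move=> aP cP ac.
suff [f [fP _]] : exists f : nat -> Spec R,
    (forall i, (i < l)%N -> prime_lt (f i) (f i.+1)) /\ forall x, x \in f l <-> c x.
  by exists f.
elim: l c cP ac => [|l IH] c cP.
  by exists (fun=> spec_of_prime cP); split=> // x; apply: mem_spec_of_prime.
move=> [b [bP ab bc ncb]]; have [f [fP fb]] := IH b bP ab.
exists (fun i => if (i <= l)%N then f i else spec_of_prime cP); split=> [i|x].
  rewrite ltnS => leil; rewrite leil; have [ltil|] := ltnP i l; first exact: fP.
  move=> leli; have -> : i = l by apply/eqP; rewrite eqn_leq leil.
  split=> [x /fb /bc /mem_spec_of_prime //|cf]; apply: ncb => x cx.
  by apply/fb/cf/mem_spec_of_prime.
by rewrite ltnn; apply: mem_spec_of_prime.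
Qed.

(* A nonzerodivisor modulo [J] lies outside some prime between [J] and [q]. *)
Lemma regular_sequence_chain (s : seq R) k q :
  noetherian R -> regular_sequence s -> (k <= size s)%N -> is_prime q ->
  subideal (generated_by (take k s)) q -> exists2 a, is_prime a & chain k a q.
Proof.
move=> noeR [_ sreg]; elim: k q => [|k IH] q lek qP sq; first by exists q; last split.
have JI := generated_by_ideal (take k s); set J := generated_by _ in JI.
have [qI q1 _] := qP.
have sub_take x : x \in take k s -> x \in take k.+1 s.
  by rewrite (take_nth 0 lek) mem_rcons inE orbC => ->.
have Jq : subideal J q.
  by apply: generated_by_sub => // x /sub_take /generated_by_mem /sq.
have qsk : q s`_k.
  by apply/sq/generated_by_mem; rewrite (take_nth 0 lek) mem_rcons mem_head.
pose S x := exists j t, ~ q t /\ x = s`_k ^+ j * t.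
have [|||a [aP Ja aS]] := @prime_avoiding _ J S noeR JI.
- by exists 0%N, 1; rewrite mulr1.
- move=> _ _ [j [t [qt ->]]] [l [u [qu ->]]]; exists (j + l)%N, (t * u).
  by split; [exact: prime_mul_notin | rewrite exprD mulrACA].
- move=> _ [j [t [qt ->]]]; elim: j => [|j IHj]; first by rewrite mul1r => /Jq.
  by rewrite exprS -mulrA => /(sreg k lek).
have [b bP ba] := IH a (ltnW lek) aP Ja.
exists b => //; exists a; split=> // [x ax|qa].
  by apply: contrapT => qx; apply: (aS x) => //; exists 0%N, x; rewrite mul1r.
by apply: (aS s`_k); [exists 1%N, 1; rewrite mulr1 | exact: qa].
Qed.

(** Used twice for the localization: its dimension is at least the length of the sequence found, and
    no regular sequence is longer than the dimension. *)
Lemma regular_sequence_has_prime_chain (s : seq R) q :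
  noetherian R -> regular_sequence s -> is_prime q -> (forall x, x \in s -> q x) ->
  has_prime_chain R (size s).
Proof.
move=> noeR sreg qP sq; have [qI _ _] := qP.
have [|a aP aq] := regular_sequence_chain noeR sreg (leqnn _) qP.
  by rewrite take_size; apply: generated_by_sub.
exact: has_prime_chain_of_chain aq.
Qed.

Lemma ideal_span_generated_by (xs ys : seq R) : xs =i ys ->
  forall u, ideal_span xs u <-> generated_by ys u.
Proof.
move=> xsys u; split.
  apply: span_over_sub; [exact: generated_by_ideal | | ].
    by move=> _ ->; have [] := generated_by_ideal ys.
  by move=> x; rewrite xsys; apply: generated_by_mem.
apply: generated_by_sub; first exact: ideal_span_is_ideal.
by move=> x; rewrite -xsys; apply/span_over_mem/zero_ideal.
Qed.

End PrimeChains.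

(** * Ideals and regular sequences of the localization at [p] *)

Section LocalizationAtPrime.
Variables (R : comNzRingType) (p : Spec R).
Notation A := (localization p).

Let q : R -> Prop := fun x => x \in p.
Let qP : is_prime q := mem_prime_is_prime p.

Definition to_loc (a : R) : A := \pi_(Localization.type p) (Localization.fracC p a).

Lemma to_locM a b : to_loc (a * b) = to_loc a * to_loc b.
Proof.
by rewrite /to_loc [RHS]Localization.pi_mul; apply: Localization.pi_eq => /=; ring.
Qed.

Lemma to_locD a b : to_loc (a + b) = to_loc a + to_loc b.
Proof.
by rewrite /to_loc [RHS]Localization.pi_add; apply: Localization.pi_eq => /=; ring.
Qed.

Lemma to_loc_eq a b : to_loc a = to_loc b -> exists2 u, ~ q u & u * a = u * b.
Proof.
move=> /eqP /Localization.equivP[u /negP pu] /=; rewrite !mulr1.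
by exists u.
Qed.

Lemma to_loc_unit s : ~ q s -> exists v : A, v * to_loc s = 1.
Proof.
move=> /negP ps; exists (\pi_(Localization.type p) (Localization.Frac 1 ps)).
rewrite [LHS]Localization.pi_mul; apply: Localization.pi_eq => /=; ring.
Qed.

Lemma to_loc_repr (x : A) : exists a s, ~ q s /\ to_loc s * x = to_loc a.
Proof.
elim/quotW: x => -[a s ps]; exists a, s; split; first exact/negP.
rewrite [LHS]Localization.pi_mul; apply: Localization.pi_eq => /=; ring.
Qed.

Lemma to_loc_cancel (I : A -> Prop) s x : is_ideal I -> ~ q s ->
  I (to_loc s * x) -> I x.
Proof.
move=> [_ _ IM] /to_loc_unit[v vs] Isx.
by rewrite -[x]mul1r -vs -mulrA; apply: IM.
Qed.

Definition contraction (I : A -> Prop) (a : R) : Prop := I (to_loc a).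

Lemma contraction_ideal I : is_ideal I -> is_ideal (contraction I).
Proof.
move=> [I0 ID IM]; rewrite /contraction; split=> // [x y Ix Iy|a x Ix].
  by rewrite to_locD; apply: ID.
by rewrite to_locM; apply: IM.
Qed.

Lemma contraction_sub (I I' : A -> Prop) : is_ideal I -> is_ideal I' ->
  subideal (contraction I) (contraction I') -> subideal I I'.
Proof.
move=> [_ _ IM] I'I II' x Ix; have [a [s [qs sx]]] := to_loc_repr x.
apply: (to_loc_cancel I'I qs); rewrite sx; apply: II'.
by rewrite /contraction -sx; apply: IM.
Qed.

Lemma contraction_prime I : is_prime I -> is_prime (contraction I).
Proof.
move=> [II I1 IM]; split=> [||x y]; [exact: contraction_ideal|exact: I1|].
by rewrite /contraction to_locM => /IM.
Qed.

Lemma contraction_proper I : is_ideal I -> ~ I 1 -> subideal (contraction I) q.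
Proof.
move=> II I1 a Ia; apply: contrapT => /to_loc_unit[v va]; apply: I1.
by rewrite -va; have [_ _] := II; apply.
Qed.

Definition extension (J : R -> Prop) (x : A) : Prop :=
  exists a s, [/\ ~ q s, J a & to_loc s * x = to_loc a].

Lemma extension_ideal J : is_ideal J -> is_ideal (extension J).
Proof.
move=> [J0 JD JM]; split.
- by exists 0, 1; split=> //; [case: qP | rewrite mulr0].
- move=> x y [a [s [qs Ja sx]]] [b [t [qt Jb ty]]]; exists (t * a + s * b), (s * t).
  split; first exact: prime_mul_notin.
    by apply: JD; apply: JM.
  by rewrite to_locD !to_locM -sx -ty; ring.
- move=> x y [a [s [qs Ja sy]]]; have [b [t [qt tx]]] := to_loc_repr x.
  exists (b * a), (t * s); split; [exact: prime_mul_notin|exact: JM|].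
  by rewrite !to_locM -sy -tx; ring.
Qed.

Lemma extension_to_loc J a : J a -> extension J (to_loc a).
Proof. by exists a, 1; split=> //; [case: qP | rewrite mul1r]. Qed.

Lemma extension_contraction J a : is_ideal J -> extension J (to_loc a) -> saturation q J a.
Proof.
move=> [_ _ JM] [b [s [qs Jb]]]; rewrite -to_locM => /to_loc_eq[u qu usa].
exists (u * s); first exact: prime_mul_notin.
by rewrite -mulrA usa; apply: JM.
Qed.

Lemma extension_proper J : is_ideal J -> subideal J q -> ~ extension J 1.
Proof.
by move=> JI Jq /(@extension_contraction J 1 JI)[s qs]; rewrite mulr1 => /Jq.
Qed.

Lemma localization_noetherian : noetherian R -> noetherian A.
Proof.
move=> noeR I [I0 IP]; pose I' (x : A) := x \in I.
have II : is_ideal I'.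
  split=> // [x y Ix Iy|a x Ix]; first by have := IP 1 x y Ix Iy; rewrite scale1r.
  by have := IP a x 0 Ix I0; rewrite addr0.
have [xs xsP] := noetherian_fg noeR (contraction_ideal II).
have gI := generated_by_ideal (map to_loc xs).
exists (map to_loc xs) => x; split; last first.
  apply: (@generated_by_sub _ _ I') => // _ /mapP[a xsa ->].
  by apply/xsP/generated_by_mem.
apply: (@contraction_sub I' (generated_by (map to_loc xs))) => // a /xsP.
apply: (@generated_by_sub _ _ (contraction (generated_by (map to_loc xs)))).
  exact: contraction_ideal.
by move=> b xsb; apply/generated_by_mem/map_f.
Qed.

(** Saturation is extension followed by contraction; this carries conditions at [p] over [R] to the
    localized ring. *)
Lemma ideal_span_to_loc xs a :
  ideal_span (map to_loc xs) (to_loc a) <-> saturation q (ideal_span xs) a.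
Proof.
have JI := ideal_span_is_ideal xs; split.
  move=> Ja; apply: extension_contraction => //.
  apply: (span_over_sub _ _ _ Ja) => [||_ /mapP[b xsb ->]].
  - exact: extension_ideal.
  - by move=> _ ->; have [] := extension_ideal JI.
  - by apply/extension_to_loc/span_over_mem/xsb/zero_ideal.
have KI := ideal_span_is_ideal (map to_loc xs).
case=> s qs Jsa; apply: (to_loc_cancel KI qs); rewrite -to_locM.
apply: (@span_over_sub _ _ (contraction (ideal_span (map to_loc xs))) xs _ _ _ _ Jsa).
- exact: contraction_ideal.
- by move=> _ ->; have [] := contraction_ideal KI.
- by move=> b xsb; apply/span_over_mem/map_f/xsb/zero_ideal.
Qed.

Lemma local_regular_sequence_sub xs : local_regular_sequence q xs ->
  forall x, x \in xs -> q x.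
Proof.
elim: xs => //= x xs IH [/IH xsq qx _] y.
by rewrite inE => /orP[/eqP->|/xsq].
Qed.

Lemma ideal_span_sub_prime xs : local_regular_sequence q xs -> subideal (ideal_span xs) q.
Proof.
move=> xsP; have [qI _ _] := qP; apply: span_over_sub => // [_ ->|].
  by case: qI.
exact: local_regular_sequence_sub.
Qed.

(** The list is reversed since [local_regular_sequence] adjoins its head last while
    [regular_sequence] reads from the left. *)
Lemma regular_sequence_to_loc xs : local_regular_sequence q xs ->
  regular_sequence (rev (map to_loc xs)).
Proof.
have spanE ys u : ideal_span (map to_loc ys) u <-> generated_by (rev (map to_loc ys)) u.
  by apply: ideal_span_generated_by => x; rewrite mem_rev.
move=> xsP; split.
  move=> /spanE /(@ideal_span_to_loc xs 1)[s qs]; rewrite mulr1.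
  by move=> /(ideal_span_sub_prime xsP).
elim: xs xsP => //= x xs IH [/IH{}IH qx xreg] i.
rewrite rev_cons size_rcons ltnS leq_eqVlt => /orP[/eqP->|lti] u; last first.
  by rewrite nth_rcons lti -cats1 takel_cat ?(ltnW lti) //; apply: IH.
rewrite nth_rcons ltnn eqxx -cats1 take_size_cat // => /spanE xu.
apply/spanE; have KI := ideal_span_is_ideal (map to_loc xs).
have [a [s [qs su]]] := to_loc_repr u.
apply: (to_loc_cancel KI qs); rewrite su; apply/ideal_span_to_loc.
have [t qt Jtxa] : saturation q (ideal_span xs) (x * a).
  apply/ideal_span_to_loc; rewrite to_locM -su mulrCA.
  by have [_ _] := KI; apply.
apply: (@saturation_saturated _ _ _ qP t) => //.
by apply: xreg; rewrite /colon -mulrA [a * x]mulrC.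
Qed.

Definition loc_max : {pred A} := fun x => `[< extension q x >].

Lemma loc_max_idealr : idealr_closed loc_max.
Proof.
have [qI q1 _] := qP; have [e0 eD eM] := extension_ideal qI; split.
- exact/asboolP.
- by apply/asboolP; apply: extension_proper.
- by move=> a x y /asboolP ex /asboolP ey; apply/asboolP/eD => //; apply: eM.
Qed.

HB.instance Definition _ := isIdealr.Build A loc_max loc_max_idealr.

Definition localization_max : idealr A := loc_max.

(** A proper ideal contracts into [p], so its elements are fractions with numerator in [p]. *)
Lemma sub_localization_max (J : idealr A) : {subset J <= localization_max}.
Proof.
move=> x Jx; pose J' (y : A) := y \in J.
have JI : is_ideal J'.
  split=> [|y z|a y]; rewrite /J' ?idealr0 //; first exact: rpredD.
  exact: idealMr.
have J1 : ~ J' 1 by rewrite /J' idealr1.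
have [a [s [qs sx]]] := to_loc_repr x; apply/asboolP; exists a, s; split=> //.
apply: (contraction_proper JI J1); rewrite /contraction -sx.
by have [_ _] := JI; apply.
Qed.

Lemma localization_local : local_ring localization_max.
Proof.
split=> [J mJ x|J Jmax x]; first by apply/idP/idP => [/sub_localization_max|/mJ].
by rewrite (Jmax localization_max (@sub_localization_max J)).
Qed.

Lemma localization_max_prime : is_prime (fun x => x \in localization_max).
Proof.
have [qI _ qM] := qP; have [e0 eD eM] := extension_ideal qI; split.
- split=> [|x y /asboolP ex /asboolP ey|a x /asboolP ex]; apply/asboolP => //.
    exact: eD.
  exact: eM.
- by move=> /asboolP; apply: extension_proper.
move=> x y /asboolP[c [s [qs qc sxy]]].
have [a [t [qt tx]]] := to_loc_repr x; have [b [u [qu uy]]] := to_loc_repr y.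
have /to_loc_eq[w qw e] : to_loc (s * (a * b)) = to_loc (t * u * c).
  by rewrite !to_locM -tx -uy -sxy; ring.
have : q (w * s * (a * b)) by rewrite -mulrA e mulrA; have [_ _] := qI; apply.
have /qM[/(prime_mul_notin qP qw qs) //|/qM[qa|qb]] : q (w * s * (a * b)).
- by rewrite -mulrA e mulrA; have [_ _] := qI; apply.
- by left; apply/asboolP; exists a, t.
- by right; apply/asboolP; exists b, u.
Qed.

Lemma localization_chain n (c : nat -> Spec A) :
  (forall i, (i < n)%N -> prime_lt (c i) (c i.+1)) ->
  chain n (contraction (fun x => x \in c 0%N)) (contraction (fun x => x \in c n)).
Proof.
have cP i : is_prime (fun x => x \in c i) := mem_prime_is_prime (c i).
have cI i : is_ideal (fun x => x \in c i) by have [] := cP i.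
elim: n => [|n IH] cc; first by split.
have [cn ncn] := cc n (leqnn _).
exists (contraction (fun x => x \in c n)); split.
- exact: contraction_prime.
- by apply: IH => i lti; apply: cc; apply: ltnW.
- by move=> a; apply: cn.
- by move=> /(contraction_sub (cI _) (cI _)).
Qed.

(** The height theorem bounds every chain by [size xs], and the regular sequence supplies a chain of
    that length; the depth is squeezed between the same bounds. *)
Lemma localization_cohen_macaulay xs : noetherian R -> local_regular_sequence q xs ->
  (forall y, q y -> exists k, saturation q (ideal_span xs) (y ^+ k)) ->
  cohen_macaulay_local A.
Proof.
move=> noeR xsP xsnil; have noeA := localization_noetherian noeR.
have xsreg := regular_sequence_to_loc xsP.
have [qI _ _] := qP; have xsq := local_regular_sequence_sub xsP.
have xsmax x : x \in rev (map to_loc xs) -> x \in localization_max.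
  by rewrite mem_rev => /mapP[a /xsq qa ->]; apply/asboolP/extension_to_loc.
have chain_le k : has_prime_chain A k -> (k <= size xs)%N.
  case=> c /localization_chain cc.
  have cP i : is_prime (fun x => x \in c i) := mem_prime_is_prime (c i).
  have [ckI ck1 _] := cP k.
  apply: (krull_height noeR qP (contraction_prime (cP 0%N)) _ cc xsq).
    exact: contraction_proper.
  (* Nilpotence modulo the span of [xs] persists after the bottom prime of the chain is added. *)
  move=> y /xsnil[j [s qs xsy]]; exists j, s => //.
  have [c0I _ _] := contraction_prime (cP 0%N).
  apply: (span_over_sub _ _ _ xsy); first exact: span_over_ideal.
    by move=> _ ->; have [] := span_over_ideal xs c0I.
  by move=> z; apply: span_over_mem.
split=> //; exists localization_max; split; first exact: localization_local.
exists (size xs); split; [split=> //|split].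
- have := regular_sequence_has_prime_chain noeA xsreg localization_max_prime xsmax.
  by rewrite size_rev size_map.
- by exists (rev (map to_loc xs)) => //; split=> //; rewrite size_rev size_map.
- move=> s smax sreg; apply: chain_le.
  exact: regular_sequence_has_prime_chain noeA sreg localization_max_prime smax.
Qed.

End LocalizationAtPrime.

Theorem corollary1p10 (R : comNzRingType) (m : idealr R)
    (localR : local_ring m) (excellentR : excellent R)
    (I : {pred R}) (idealI : ideal I)
    (nonCM : forall p : Spec R,
       V I p <-> ~ cohen_macaulay_local (localization p)) :
  forall p : Spec R, V I p ->
  forall (E : lmodType R) (i : {linear (quotient_module p) -> E}),
    injective_envelope i -> pd_infinite E.
Proof.
move=> p /nonCM nCM E i hullE n [P [d [e resE]]]; apply: nCM.
have [noeR _ _ _] := excellentR.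
have [xs xsP xsnil] := nilpotent_regular_sequence noeR hullE resE.
exact: localization_cohen_macaulay noeR xsP xsnil.
Qed.
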